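(* Let $T$ be a finite biquandle. For a finitely presented biquandle $K$, let $\mathrm{Hom}(K,T)$ be the set of biquandle homomorphisms from $K$ to $T$. Then the cardinality $|\mathrm{Hom}(K,T)|$ is an invariant of biquandle isomorphism type: if $K$ and $K'$ are isomorphic finitely presented biquandles, then $|\mathrm{Hom}(K,T)|=|\mathrm{Hom}(K',T)|$. Hence it is an invariant of virtual isotopy: if $D$ and $D'$ are oriented virtual knot or link diagrams which are virtually isotopic, with knot biquandles $K_D$ and $K_{D'}$, then $|\mathrm{Hom}(K_D,T)|=|\mathrm{Hom}(K_{D'},T)|$.
   Context: A biquandle is a set $B$ with four binary operations $B\times B\to B$, written $(a,b)\mapsto a^b,\ a^{\bar b},\ a_b,\ a_{\bar b}$. Conventions: a bar over an element or expression in an exponent (subscript) position means that the barred upper (lower) operation with that element is used; thus $a^{\overline{w}}$ is the operation $(a,w)\mapsto a^{\bar w}$, and $a_{\overline{w}}$ is $(a,w)\mapsto a_{\bar w}$. The axioms are: (1) For all $a,b\in B$: (i) $a=(a^b)^{\overline{b_a}}$; (ii) $b=(b_a)_{\overline{a^b}}$; (iii) $a=(a^{\bar b})^{b_{\bar a}}$; (iv) $b=(b_{\bar a})_{a^{\bar b}}$. (2) For all $a,b\in B$ there are $x,y\in B$ such that (i) $x=a^{(b_{\bar x})}$; (ii) $a=x^{\bar b}$; (iii) $b=(b_{\bar x})_a$; (iv) $y=a^{\overline{b_y}}$; (v) $a=y^b$; (vi) $b=(b_y)_{\bar a}$. (3) For all $a,b,c\in B$: (i) $(a^b)^c=(a^{c_b})^{b^c}$;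 (ii) $(c_b)_a=(c_{a^b})_{b_a}$; (iii) $(b_a)^{c_{a^b}}=(b^c)_{a^{c_b}}$; (iv) $(a^{\bar b})^{\bar c}=(a^{\overline{c_{\bar b}}})^{\overline{b^{\bar c}}}$; (v) $(c_{\bar b})_{\bar a}=(c_{\overline{a^{\bar b}}})_{\overline{b_{\bar a}}}$; (vi) $(b_{\bar a})^{\overline{w}}=(b^{\bar c})_{\overline{v}}$ where $w=c_{\overline{a^{\bar b}}}$ and $v=a^{\overline{c_{\bar b}}}$. (4) For every $a\in B$ there are $x,y\in B$ such that (i) $x=a_x$; (ii) $a=x^a$; (iii) $y=a^{\bar y}$; (iv) $a=y_{\bar a}$. A biquandle homomorphism is a map $\phi$ preserving all four operations: $\phi(a^b)=\phi(a)^{\phi(b)}$, $\phi(a^{\bar b})=\phi(a)^{\overline{\phi(b)}}$, $\phi(a_b)=\phi(a)_{\phi(b)}$, $\phi(a_{\bar b})=\phi(a)_{\overline{\phi(b)}}$; an isomorphism is a bijective homomorphism. Presentations: for a finite set $X$, the set $BW(X)$ of biquandle words in $X$ consists of the elements of $X$ together with all finite strings of the forms $a^b,\ a^{\bar b},\ a_b,\ a_{\bar b},\ X(a,b),\ Y(a,b),\ Fx(a),\ Fy(a)$ with $a,b\in BW(X)$. The free biquandle on $X$ is the set of equivalence classes of $BW(X)$ under the equivalence relation (compatible with the operations) generated by the relations required by the biquandle axioms, where $X(a,b)$ and $Y(a,b)$ play the roles of the elements $x,y$ of axiom (2) for $a,b$, and $Fx(a)$, $Fy(a)$ play the roles of the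 elements $x,y$ of axiom (4) for $a$. A finitely presented biquandle is the quotient of the free biquandle on a finite set by the equivalence relation (compatible with the operations) generated by a finite list of equivalences of biquandle words. Knot biquandle: given an oriented virtual knot or link diagram, divide it at each classical crossing, both at the over- and the undercrossing points, into semiarcs (virtual crossings do not divide). The knot biquandle is the finitely presented biquandle with one generator for each semiarc and two relations at each classical crossing: if $a$ is the inbound under-semiarc and $b$ is the inbound over-semiarc, then at a positive crossing the outbound under-semiarc equals $a^b$ and the outbound over-semiarc equals $b_a$, while at a negative crossing they equal $a^{\bar b}$ and $b_{\bar a}$ respectively. Two virtual diagrams are virtually isotopic if they are related by a finite sequence of the oriented Reidemeister moves and the purely virtual and mixed (detour) moves of virtual knot theory. *)

(* Defs.v *)
From HB Require Import structures.
From mathcomp Require Import all_boot.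
From mathcomp Require Import generic_quotient.
From mathcomp Require Import boolp classical_sets functions cardinality.
From Stdlib Require Import Relation_Operators.

Set Implicit Arguments.
Unset Strict Implicit.
Unset Printing Implicit Defensive.

Local Open Scope quotient_scope.

(* up a b = a^b, upb a b = a^(bar b), dn a b = a_b, dnb a b = a_(bar b).      *)
HB.mixin Record isBiquandle (B : Type) := {
  up : B -> B -> B;
  upb : B -> B -> B;
  dn : B -> B -> B;
  dnb : B -> B -> B;
  bq1_i : forall a b, a = upb (up a b) (dn b a);
  bq1_ii : forall a b, b = dnb (dn b a) (up a b);
  bq1_iii : forall a b, a = up (upb a b) (dnb b a);
  bq1_iv : forall a b, b = dn (dnb b a) (upb a b);
  bq2 : forall a b, exists x y,
    (x = up a (dnb b x) /\ a = upb x b /\ b = dn (dnb b x) a) /\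
    (y = upb a (dn b y) /\ a = up y b /\ b = dnb (dn b y) a);
  bq3_i : forall a b c,
    up (up a b) c = up (up a (dn c b)) (up b c);
  bq3_ii : forall a b c,
    dn (dn c b) a = dn (dn c (up a b)) (dn b a);
  bq3_iii : forall a b c,
    up (dn b a) (dn c (up a b)) = dn (up b c) (up a (dn c b));
  bq3_iv : forall a b c,
    upb (upb a b) c = upb (upb a (dnb c b)) (upb b c);
  bq3_v : forall a b c,
    dnb (dnb c b) a = dnb (dnb c (upb a b)) (dnb b a);
  bq3_vi : forall a b c,
    upb (dnb b a) (dnb c (upb a b)) = dnb (upb b c) (upb a (dnb c b));
  bq4 : forall a, exists x y,
    (x = dn a x /\ a = up x a) /\ (y = upb a y /\ a = dnb y a)
}.

#[short(type="biquandleType")]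
HB.structure Definition Biquandle := {B of isBiquandle B}.

#[short(type="finBiquandleType")]
HB.structure Definition FinBiquandle := {B of isBiquandle B & Finite B}.

Definition is_hom (K L : biquandleType) (phi : K -> L) : Prop :=
  [/\ forall a b, phi (up a b) = up (phi a) (phi b),
      forall a b, phi (upb a b) = upb (phi a) (phi b),
      forall a b, phi (dn a b) = dn (phi a) (phi b) &
      forall a b, phi (dnb a b) = dnb (phi a) (phi b)].

Definition Hom (K L : biquandleType) : set (K -> L) :=
  [set phi | is_hom phi]%classic.
Arguments Hom : clear implicits.

Definition isomorphic (K L : biquandleType) : Prop :=
  exists phi : K -> L, is_hom phi /\ bijective phi.

Inductive word (X : Type) : Type :=
| Gen of X
| Wup of word X & word X
| Wupb of word X & word X
| Wdn of word X & word X
| Wdnb of word X & word X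
| WX of word X & word X
| WY of word X & word X
| WFx of word X
| WFy of word X.

HB.instance Definition _ (X : Type) := gen_eqMixin (word X).
HB.instance Definition _ (X : Type) := gen_choiceMixin (word X).

Record presentation := Presentation {
  gens : finType;
  rels : seq (word gens * word gens)
}.

(* The equivalence relation on words, compatible with all word-forming        *)
(* operations, generated by the biquandle axioms and by the relations of P.   *)
(* For rels P = [::] its classes form the free biquandle on gens P; for       *)
(* general P they form the quotient of that free biquandle by the relations.  *)
Inductive word_equiv (P : presentation) :
  word (gens P) -> word (gens P) -> Prop :=
| we_rel u v : (u, v) \in rels P -> word_equiv u v
| we_refl u : word_equiv u u
| we_sym u v : word_equiv u v -> word_equiv v u
| we_trans u v w : word_equiv u v -> word_equiv v w -> word_equiv u w
| we_up u u' v v' : word_equiv u u' -> word_equiv v v' ->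
    word_equiv (Wup u v) (Wup u' v')
| we_upb u u' v v' : word_equiv u u' -> word_equiv v v' ->
    word_equiv (Wupb u v) (Wupb u' v')
| we_dn u u' v v' : word_equiv u u' -> word_equiv v v' ->
    word_equiv (Wdn u v) (Wdn u' v')
| we_dnb u u' v v' : word_equiv u u' -> word_equiv v v' ->
    word_equiv (Wdnb u v) (Wdnb u' v')
| we_X u u' v v' : word_equiv u u' -> word_equiv v v' ->
    word_equiv (WX u v) (WX u' v')
| we_Y u u' v v' : word_equiv u u' -> word_equiv v v' ->
    word_equiv (WY u v) (WY u' v')
| we_Fx u u' : word_equiv u u' -> word_equiv (WFx u) (WFx u')
| we_Fy u u' : word_equiv u u' -> word_equiv (WFy u) (WFy u')
| we_1_i a b : word_equiv a (Wupb (Wup a b) (Wdn b a))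
| we_1_ii a b : word_equiv b (Wdnb (Wdn b a) (Wup a b))
| we_1_iii a b : word_equiv a (Wup (Wupb a b) (Wdnb b a))
| we_1_iv a b : word_equiv b (Wdn (Wdnb b a) (Wupb a b))
| we_2_i a b : word_equiv (WX a b) (Wup a (Wdnb b (WX a b)))
| we_2_ii a b : word_equiv a (Wupb (WX a b) b)
| we_2_iii a b : word_equiv b (Wdn (Wdnb b (WX a b)) a)
| we_2_iv a b : word_equiv (WY a b) (Wupb a (Wdn b (WY a b)))
| we_2_v a b : word_equiv a (Wup (WY a b) b)
| we_2_vi a b : word_equiv b (Wdnb (Wdn b (WY a b)) a)
| we_3_i a b c :
    word_equiv (Wup (Wup a b) c) (Wup (Wup a (Wdn c b)) (Wup b c))
| we_3_ii a b c :
    word_equiv (Wdn (Wdn c b) a) (Wdn (Wdn c (Wup a b)) (Wdn b a))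
| we_3_iii a b c :
    word_equiv (Wup (Wdn b a) (Wdn c (Wup a b)))
               (Wdn (Wup b c) (Wup a (Wdn c b)))
| we_3_iv a b c :
    word_equiv (Wupb (Wupb a b) c) (Wupb (Wupb a (Wdnb c b)) (Wupb b c))
| we_3_v a b c :
    word_equiv (Wdnb (Wdnb c b) a) (Wdnb (Wdnb c (Wupb a b)) (Wdnb b a))
| we_3_vi a b c :
    word_equiv (Wupb (Wdnb b a) (Wdnb c (Wupb a b)))
               (Wdnb (Wupb b c) (Wupb a (Wdnb c b)))
| we_4_i a : word_equiv (WFx a) (Wdn a (WFx a))
| we_4_ii a : word_equiv a (Wup (WFx a) a)
| we_4_iii a : word_equiv (WFy a) (Wupb a (WFy a))
| we_4_iv a : word_equiv a (Wdnb (WFy a) a).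

Definition word_equivb (P : presentation) : rel (word (gens P)) :=
  fun u v => `[< word_equiv u v >].

Section Presented.
Variable P : presentation.
Implicit Types u v w : word (gens P).

Lemma word_equivb_refl : reflexive (@word_equivb P).
Proof. by move=> u; apply/asboolP; apply: we_refl. Qed.

Lemma word_equivb_sym : symmetric (@word_equivb P).
Proof. by move=> u v; apply/asboolP/asboolP; apply: we_sym. Qed.

Lemma word_equivb_trans : transitive (@word_equivb P).
Proof.
move=> v u w /asboolP uv /asboolP vw; apply/asboolP; exact: we_trans uv vw.
Qed.

Canonical word_equiv_rel :=
  EquivRel (@word_equivb P) word_equivb_refl word_equivb_sym word_equivb_trans.

Definition presented : Type := {eq_quot word_equiv_rel}.

HB.instance Definition _ := Quotient.on presented.
HB.instance Definition _ := EqQuotient.on presented.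

Let cls u : presented := \pi_presented u.

Lemma presented_eqP u v : (cls u = cls v) <-> word_equiv u v.
Proof.
split=> [/eqmodP /asboolP // | uv]; apply/eqmodP; exact/asboolP.
Qed.

Let op2 (f : word (gens P) -> word (gens P) -> word (gens P))
  (a b : presented) : presented := cls (f (repr a) (repr b)).

Let op2E f : (forall u u' v v', word_equiv u u' -> word_equiv v v' ->
    word_equiv (f u v) (f u' v')) ->
  forall u v, op2 f (cls u) (cls v) = cls (f u v).
Proof.
move=> fP u v; apply/presented_eqP; apply: fP; apply/presented_eqP;
  by rewrite /cls reprK.
Qed.

Let upE := op2E (@we_up P).
Let upbE := op2E (@we_upb P).
Let dnE := op2E (@we_dn P).
Let dnbE := op2E (@we_dnb P).
Let opE := (upE, upbE, dnE, dnbE).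

Let clsP (a : presented) : exists u, a = cls u.
Proof. by exists (repr a); rewrite /cls reprK. Qed.

Local Ltac bq_axiom H :=
  repeat (let a := fresh "a" in intro a; case: (clsP a) => ? ->);
  rewrite ?opE; apply/presented_eqP; exact: H.

Fact presented_bq1_i a b : a = op2 (@Wupb _) (op2 (@Wup _) a b) (op2 (@Wdn _) b a).
Proof. move: a b; bq_axiom we_1_i. Qed.
Fact presented_bq1_ii a b : b = op2 (@Wdnb _) (op2 (@Wdn _) b a) (op2 (@Wup _) a b).
Proof. move: a b; bq_axiom we_1_ii. Qed.
Fact presented_bq1_iii a b : a = op2 (@Wup _) (op2 (@Wupb _) a b) (op2 (@Wdnb _) b a).
Proof. move: a b; bq_axiom we_1_iii. Qed.
Fact presented_bq1_iv a b : b = op2 (@Wdn _) (op2 (@Wdnb _) b a) (op2 (@Wupb _) a b).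
Proof. move: a b; bq_axiom we_1_iv. Qed.

Fact presented_bq2 a b : exists x y,
  (x = op2 (@Wup _) a (op2 (@Wdnb _) b x) /\ a = op2 (@Wupb _) x b /\
   b = op2 (@Wdn _) (op2 (@Wdnb _) b x) a) /\
  (y = op2 (@Wupb _) a (op2 (@Wdn _) b y) /\ a = op2 (@Wup _) y b /\
   b = op2 (@Wdnb _) (op2 (@Wdn _) b y) a).
Proof.
case: (clsP a) => u ->; case: (clsP b) => v ->.
exists (cls (WX u v)), (cls (WY u v)); rewrite !opE.
split; (split; last split); apply/presented_eqP.
- exact: we_2_i.
- exact: we_2_ii.
- exact: we_2_iii.
- exact: we_2_iv.
- exact: we_2_v.
- exact: we_2_vi.
Qed.

Fact presented_bq3_i a b c :
  op2 (@Wup _) (op2 (@Wup _) a b) c =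
  op2 (@Wup _) (op2 (@Wup _) a (op2 (@Wdn _) c b)) (op2 (@Wup _) b c).
Proof. move: a b c; bq_axiom we_3_i. Qed.
Fact presented_bq3_ii a b c :
  op2 (@Wdn _) (op2 (@Wdn _) c b) a =
  op2 (@Wdn _) (op2 (@Wdn _) c (op2 (@Wup _) a b)) (op2 (@Wdn _) b a).
Proof. move: a b c; bq_axiom we_3_ii. Qed.
Fact presented_bq3_iii a b c :
  op2 (@Wup _) (op2 (@Wdn _) b a) (op2 (@Wdn _) c (op2 (@Wup _) a b)) =
  op2 (@Wdn _) (op2 (@Wup _) b c) (op2 (@Wup _) a (op2 (@Wdn _) c b)).
Proof. move: a b c; bq_axiom we_3_iii. Qed.
Fact presented_bq3_iv a b c :
  op2 (@Wupb _) (op2 (@Wupb _) a b) c =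
  op2 (@Wupb _) (op2 (@Wupb _) a (op2 (@Wdnb _) c b)) (op2 (@Wupb _) b c).
Proof. move: a b c; bq_axiom we_3_iv. Qed.
Fact presented_bq3_v a b c :
  op2 (@Wdnb _) (op2 (@Wdnb _) c b) a =
  op2 (@Wdnb _) (op2 (@Wdnb _) c (op2 (@Wupb _) a b)) (op2 (@Wdnb _) b a).
Proof. move: a b c; bq_axiom we_3_v. Qed.
Fact presented_bq3_vi a b c :
  op2 (@Wupb _) (op2 (@Wdnb _) b a) (op2 (@Wdnb _) c (op2 (@Wupb _) a b)) =
  op2 (@Wdnb _) (op2 (@Wupb _) b c) (op2 (@Wupb _) a (op2 (@Wdnb _) c b)).
Proof. move: a b c; bq_axiom we_3_vi. Qed.

Fact presented_bq4 a : exists x y,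
  (x = op2 (@Wdn _) a x /\ a = op2 (@Wup _) x a) /\
  (y = op2 (@Wupb _) a y /\ a = op2 (@Wdnb _) y a).
Proof.
case: (clsP a) => u ->; exists (cls (WFx u)), (cls (WFy u)); rewrite !opE.
split; split; apply/presented_eqP.
- exact: we_4_i.
- exact: we_4_ii.
- exact: we_4_iii.
- exact: we_4_iv.
Qed.

HB.instance Definition _ := isBiquandle.Build presented
  presented_bq1_i presented_bq1_ii presented_bq1_iii presented_bq1_iv
  presented_bq2 presented_bq3_i presented_bq3_ii presented_bq3_iii
  presented_bq3_iv presented_bq3_v presented_bq3_vi presented_bq4.

End Presented.

Definition finitely_presented (K : biquandleType) : Prop :=
  exists P : presentation, isomorphic K (presented P).

(* An oriented virtual link diagram in the plane is put in general position   *)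
(* with respect to the height function and cut by horizontal lines into       *)
(* slices, read from bottom to top, each containing exactly one local         *)
(* minimum, local maximum or crossing. The pair (i, p) is the slice with i    *)
(* vertical strands to the left of the piece p.                               *)

(* Classical true: the strand joining bottom left to top right passes over.   *)
Inductive crossing := Virtual | Classical of bool.

(* Cup b is a local minimum, with its left end oriented upwards iff b; Cap is *)
(* a local maximum.                                                           *)
Inductive piece := Cup of bool | Cap | Cross of crossing.

Definition slice : Type := nat * piece.

Definition bottom (p : piece) : nat := if p is Cup _ then 0 else 2.
Definition top (p : piece) : nat := if p is Cap then 0 else 2.

(* A level lists from left to right the orientations of the strands meeting a *)
(* horizontal line (true for upwards). The partial map below sends the level  *)
(* under a slice to the level above it.                                       *)
Definition step (s : slice) (l : seq bool) : option (seq bool) :=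
  let: (i, p) := s in
  let x := nth true l i in let y := nth true l i.+1 in
  if i + bottom p <= size l then
    match p with
    | Cup b => Some (take i l ++ [:: b; ~~ b] ++ drop i l)
    | Cap => if x != y then Some (take i l ++ drop i.+2 l) else None
    | Cross _ => Some (take i l ++ [:: y; x] ++ drop i.+2 l)
    end
  else None.

Definition run (w : seq slice) (l : seq bool) : option (seq bool) :=
  foldl (fun o s => obind (step s) o) (Some l) w.

Record diagram := Diagram {
  slices :> seq slice;
  diagramP : run slices [::] = Some [::]
}.

Definition level (w : seq slice) (j : nat) : seq bool :=
  odflt [::] (run (take j w) [::]).

(* The points where the diagram meets the horizontal lines; (j, k) is the     *)
(* k-th point from the left on the line below slice j.                        *)
Definition point (D : diagram) : finType :=
  {j : 'I_(size D).+1 & 'I_(size (level D j))}.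

Definition loc (D : diagram) (x : point D) : nat * nat :=
  (nat_of_ord (tag x), nat_of_ord (tagged x)).

(* Location x is joined to location y, inside slice number j, by an arc that  *)
(* contains neither a classical over- nor a classical undercrossing point.    *)
Definition joined_in (j : nat) (s : slice) (x y : nat * nat) : bool :=
  let: (i, p) := s in
  [|| [&& x.1 == j, y.1 == j.+1, x.2 < i & y.2 == x.2],
      [&& x.1 == j, y.1 == j.+1, i + bottom p <= x.2 &
          y.2 + bottom p == x.2 + top p] |
      match p with
      | Cup _ => (x == (j.+1, i)) && (y == (j.+1, i.+1))
      | Cap => (x == (j, i)) && (y == (j, i.+1))
      | Cross Virtual =>
          (x == (j, i)) && (y == (j.+1, i.+1)) ||
          (x == (j, i.+1)) && (y == (j.+1, i))
      | Cross (Classical _) => false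
      end].

Definition joined (D : diagram) : rel (point D) := fun x y =>
  [exists j : 'I_(size D),
     let s := nth (0, Cap) D j in
     joined_in j s (loc x) (loc y) || joined_in j s (loc y) (loc x)].

(* A semiarc is represented by the set of points lying on it.                 *)
Definition semiarc_set (D : diagram) (x : point D) : {set point D} :=
  [set y | connect (@joined D) x y].

Definition semiarc (D : diagram) : finType :=
  {A : {set point D} | A \in codom (@semiarc_set D)}.

Definition semiarc_of (D : diagram) (x : point D) : semiarc D :=
  exist _ (semiarc_set x) (codom_f (@semiarc_set D) x).

(* The points ui, oi, uo, oo are the inbound under-, inbound over-, outbound  *)
(* under- and outbound over-ends of one classical crossing, which is positive *)
(* iff pos. Strand a joins bottom left to top right and strand b joins bottom *)
(* right to top left. A crossing of two parallel strands is positive iff a    *)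
(* passes over; reversing one strand changes the sign.                        *)
Definition crossing_ends (D : diagram)
    (q : bool * (point D * point D) * (point D * point D)) : bool :=
  let: (pos, (ui, oi), (uo, oo)) := q in
  [exists j : 'I_(size D),
     if nth (0, Cap) D j is (i, Cross (Classical a_over)) then
       let a_up := nth true (level D j) i in
       let b_up := nth true (level D j) i.+1 in
       let a := if a_up then ((val j, i), (j.+1, i.+1))
                else ((j.+1, i.+1), (val j, i)) in
       let b := if b_up then ((val j, i.+1), (j.+1, i))
                else ((j.+1, i), (val j, i.+1)) in
       let over := if a_over then a else b in
       let under := if a_over then b else a in
       [&& pos == (a_over == (a_up == b_up)),
           (loc ui, loc uo) == under & (loc oi, loc oo) == over]
     else false].

Definition crossing_rels (D : diagram)
    (q : bool * (point D * point D) * (point D * point D)) :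
    seq (word (semiarc D) * word (semiarc D)) :=
  let: (pos, (ui, oi), (uo, oo)) := q in
  let g x := Gen (semiarc_of x) in
  if pos then [:: (g uo, Wup (g ui) (g oi)); (g oo, Wdn (g oi) (g ui))]
  else [:: (g uo, Wupb (g ui) (g oi)); (g oo, Wdnb (g oi) (g ui))].

Definition knot_presentation (D : diagram) : presentation :=
  @Presentation (semiarc D)
    (flatten [seq crossing_rels q | q <- enum (@crossing_ends D)]).

Definition knot_biquandle (D : diagram) : biquandleType :=
  presented (knot_presentation D).

(* Exchanges the roles of the two diagonal strands.                           *)
Definition flip (c : crossing) : crossing :=
  if c is Classical b then Classical (~~ b) else Virtual.

(* Strands 1, 2, 3 cross pairwise; the strand with the smaller number joins   *)
(* bottom left to top right. All crossings classical: the over/under data     *)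
(* must not be cyclic. Mixed: exactly two crossings are virtual (the moves    *)
(* with exactly one virtual crossing are forbidden).                          *)
Definition triple_ok (c12 c13 c23 : crossing) : bool :=
  match c12, c13, c23 with
  | Classical x, Classical y, Classical z => ~~ ((x == z) && (x != y))
  | Virtual, Virtual, _ | Virtual, _, Virtual | _, Virtual, Virtual => true
  | _, _, _ => false
  end.

(* The first five moves generate planar isotopy of diagrams in general        *)
(* position: exchange of heights of two distant pieces, cancellation of a     *)
(* minimum with a maximum, and passage of a minimum or maximum through a      *)
(* crossing. The others are the Reidemeister moves; they are classical,       *)
(* purely virtual or mixed according to their crossings, and all orientations *)
(* of the strands occur since those are determined by the levels.             *)
Inductive move : seq slice -> seq slice -> Prop :=
| far_exchange i d p q :
    move [:: (i, p); (i + top p + d, q)] [:: (i + bottom p + d, q); (i, p)]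
| zigzag_left i b : move [:: (i, Cup b); (i.+1, Cap)] [::]
| zigzag_right i b : move [:: (i.+1, Cup b); (i, Cap)] [::]
| slide_cup i b c :
    move [:: (i, Cup b); (i.+1, Cross c)] [:: (i.+1, Cup b); (i, Cross (flip c))]
| slide_cap i c :
    move [:: (i.+1, Cross c); (i, Cap)] [:: (i, Cross (flip c)); (i.+1, Cap)]
| reidemeister1_right i b c :
    move [:: (i.+1, Cup b); (i, Cross c); (i.+1, Cap)] [::]
| reidemeister1_left i b c :
    move [:: (i, Cup b); (i.+1, Cross c); (i, Cap)] [::]
| reidemeister2 i c :
    move [:: (i, Cross c); (i, Cross (flip c))] [::]
| reidemeister3 i c12 c13 c23 : triple_ok c12 c13 c23 ->
    move [:: (i, Cross c12); (i.+1, Cross c13); (i, Cross c23)]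
         [:: (i.+1, Cross c23); (i, Cross c13); (i.+1, Cross c12)].

Definition diagram_move (D D' : diagram) : Prop :=
  exists u v w w', [/\ move w w', D = u ++ w ++ v :> seq slice &
                       D' = u ++ w' ++ v :> seq slice].

Definition virtually_isotopic (D D' : diagram) : Prop :=
  clos_refl_sym_trans diagram diagram_move D D'.

(* Main.v *)
Require Import Defs.
From mathcomp Require Import all_boot.
From mathcomp Require Import generic_quotient.
From mathcomp Require Import boolp classical_sets functions cardinality.
From mathcomp Require Import zify.

(* Axiom 2 makes the maps x |-> x^b and its three analogues surjective on T, so
   when T is finite they are bijective and the elements x, y of axioms 2 and 4
   are unique. Hence a homomorphism from a presented biquandle to T is the same
   as an assignment of the generators that satisfies the relations, and Hom(K_D, T)
   is the set of colorings of the points of D. Read slice by slice from the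
   bottom, a coloring is a path of colored levels, so that the number of
   colorings is a matrix product; it then suffices that the two sides of each
   move have the same matrix entries. The relation that a crossing imposes on its
   four ends is unchanged by a quarter turn of the plane and can be solved for any
   two adjacent ends, whence the planar moves and Reidemeister II; for
   Reidemeister I and for all orientations of Reidemeister III, the axioms settle
   one orientation and a counting argument (an injective map of a finite set is
   onto) the others. *)

Set Implicit Arguments.
Unset Strict Implicit.
Unset Printing Implicit Defensive.

(** * The relation at a crossing *)

Lemma fin_surj_inj (T : finType) (f : T -> T) :
  (forall y, exists x, f x = y) -> injective f.
Proof.
move=> /choice [g gK]; have [h hK Kh] := injF_bij (can_inj gK).
by move=> x y; rewrite -(Kh x) -(Kh y) !gK => ->.
Qed.

Lemma fin_inj_surj (T : finType) (f : T -> T) :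
  injective f -> forall y, exists x, f x = y.
Proof. by move=> /injF_bij [g _ gK] y; exists (g y). Qed.

Section CrossingRelation.
Variable T : finBiquandleType.
Implicit Types a b c u o x y z : T.

(* The inbound under- and over-ends u, o and the outbound ones u', o' of a
   positive crossing; at a negative crossing the same relation holds with inbound
   and outbound exchanged, by [xing_neg]. *)
Definition xing u o u' o' := u' = up u o /\ o' = dn o u.

Lemma xing_neg u o u' o' : (u' = upb u o /\ o' = dnb o u) <-> xing u' o' u o.
Proof.
split=> -[-> ->]; split; [exact: bq1_iii|exact: bq1_iv|exact: bq1_i|exact: bq1_ii].
Qed.

Lemma up_inj b : injective (up^~ b).
Proof.
apply: fin_surj_inj => a; have [x [y [_ [_ [ey _]]]]] := bq2 a b.
by exists y.
Qed.

Lemma dn_inj a : injective (dn^~ a).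
Proof.
apply: fin_surj_inj => b; have [x [y [[_ [_ ex]] _]]] := bq2 a b.
by exists (dnb b x).
Qed.

(** Around a crossing the ends come in the cyclic order u, o, u', o'. Prescribing two neighbors
    leaves exactly one solution: existence for the four pairs is shown here, the mixed pairs being
    axiom 2, and uniqueness by the [xing_inj_*] lemmas, where finiteness enters through [up_inj] and
    [dn_inj]. *)
Lemma xing_io u o : exists u' o', xing u o u' o'.
Proof. by exists (up u o), (dn o u). Qed.

Lemma xing_oi u' o' : exists u o, xing u o u' o'.
Proof. by exists (upb u' o'), (dnb o' u'); apply/xing_neg. Qed.

Lemma xing_ii_oo u o' : exists o u', xing u o u' o'.
Proof.
have [x [_ [[ex [_ eo]] _]]] := bq2 u o'.
by exists (dnb o' x), x.
Qed.

Lemma xing_uo_oi u' o : exists u o', xing u o u' o'.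
Proof.
have [_ [y [_ [ey [eu _]]]]] := bq2 u' o.
by exists y, (dn o y).
Qed.

Lemma xing_inj_in u o u1 o1 u2 o2 :
  xing u o u1 o1 -> xing u o u2 o2 -> u1 = u2 /\ o1 = o2.
Proof. by move=> [-> ->] [-> ->]. Qed.

Lemma xing_inj_out u o u1 o1 u2 o2 :
  xing u1 o1 u o -> xing u2 o2 u o -> u1 = u2 /\ o1 = o2.
Proof. by move=> /xing_neg [-> ->] /xing_neg [-> ->]. Qed.

Lemma xing_inj_under_in u o u1 o1 u2 o2 :
  xing u o1 u1 o -> xing u o2 u2 o -> u1 = u2 /\ o1 = o2.
Proof.
by move=> [-> e1] [-> e2]; have <- : o1 = o2 by apply: (@dn_inj u); rewrite -e1.
Qed.

Lemma xing_inj_over_in u o u1 o1 u2 o2 :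
  xing u1 o u o1 -> xing u2 o u o2 -> u1 = u2 /\ o1 = o2.
Proof.
by move=> [e1 ->] [e2 ->]; have <- : u1 = u2 by apply: (@up_inj o); rewrite -e1.
Qed.

(** Identifies crossings that agree on two neighboring ends, until no such pair is left. *)
Local Ltac saturate :=
  repeat match goal with
  | H1 : xing ?u ?o _ _, H2 : xing ?u ?o _ _ |- _ =>
    case: (xing_inj_in H1 H2) => ? ?; subst; clear H2
  | H1 : xing _ _ ?u ?o, H2 : xing _ _ ?u ?o |- _ =>
    case: (xing_inj_out H1 H2) => ? ?; subst; clear H2
  | H1 : xing ?u _ _ ?o, H2 : xing ?u _ _ ?o |- _ =>
    case: (xing_inj_under_in H1 H2) => ? ?; subst; clear H2
  | H1 : xing _ ?o ?u _, H2 : xing _ ?o ?u _ |- _ =>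
    case: (xing_inj_over_in H1 H2) => ? ?; subst; clear H2
  end.

(** * Kinks *)

Lemma loop_under_ex c : exists x, xing x c c x.
Proof. by have [x [_ [[e1 e2] _]]] := bq4 c; exists x. Qed.

(** Axiom 4 gives a map from c to x. It is injective because x occupies two neighboring ends, which
    determine c; by finiteness it is onto. *)
Lemma loop_over_ex x : exists c, xing x c c x.
Proof.
have [f fP] := choice loop_under_ex.
have f_inj : injective f.
  by move=> c d e; have := fP c; have := fP d; rewrite e => ? ?; saturate.
by have [c <-] := fin_inj_surj f_inj x; exists c.
Qed.

(** The symmetric kink given by [loop_over_ex] shares the two neighboring ends x with this crossing,
    hence coincides with it. So a strand leaves a kink with the color it had on entering. *)
Lemma loop_over x c d : xing x c d x -> c = d.
Proof. by have [e ?] := loop_over_ex x => ?; saturate. Qed.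

Lemma loop_under x c d : xing x c c d -> x = d.
Proof. by have [e ?] := loop_under_ex c => ?; saturate. Qed.

Lemma loop_inj_over x c d : xing x c c x -> xing x d d x -> c = d.
Proof. by move=> ? ?; saturate. Qed.

Lemma loop_inj_under x y c : xing x c c x -> xing y c c y -> x = y.
Proof. by move=> ? ?; saturate. Qed.

(** * The cube of Reidemeister III *)

(* The two sides of a Reidemeister III move between a top, a middle and a bottom
   strand have the same six outer ends. Glued there, their 12 arcs are the edges,
   and their 6 crossings the faces, of a cube; t01 and t10 are the inner arcs of
   the top strand on the two sides. *)
Definition cube (t0 t01 t10 t1 m0 m01 m10 m1 b0 b01 b10 b1 : T) :=
  [/\ xing m0 t0 m01 t01, xing b0 t01 b01 t1 & xing b01 m01 b1 m1] /\
  [/\ xing b0 m0 b10 m10, xing b10 t0 b1 t10 & xing m10 t10 m1 t1].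

Lemma cube_ex t0 m0 b0 : exists t01 t10 t1 m01 m10 m1 b01 b10 b1,
  cube t0 t01 t10 t1 m0 m01 m10 m1 b0 b01 b10 b1.
Proof.
do 9!eexists; split; split; split; try reflexivity.
(* The two sides must agree on the outgoing arcs b1, m1 and t1, in this order. *)
- by rewrite -bq3_i.
- by rewrite -bq3_iii.
- by rewrite -bq3_ii.
Qed.

(* A cube is determined by its edges t0, m0, b0, which are arbitrary: if three
   other edges determine these, the finiteness of T^3 makes them arbitrary too. *)
Lemma cube_at
    (pr : T -> T -> T -> T -> T -> T -> T -> T -> T -> T -> T -> T -> T * T * T) :
  (forall t0 t01 t10 t1 m0 m01 m10 m1 b0 b01 b10 b1
          s0 s01 s10 s1 n0 n01 n10 n1 c0 c01 c10 c1,
     cube t0 t01 t10 t1 m0 m01 m10 m1 b0 b01 b10 b1 ->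
     cube s0 s01 s10 s1 n0 n01 n10 n1 c0 c01 c10 c1 ->
     pr t0 t01 t10 t1 m0 m01 m10 m1 b0 b01 b10 b1 =
     pr s0 s01 s10 s1 n0 n01 n10 n1 c0 c01 c10 c1 ->
     [/\ t0 = s0, m0 = n0 & b0 = c0]) ->
  forall e, exists t0 t01 t10 t1 m0 m01 m10 m1 b0 b01 b10 b1,
    cube t0 t01 t10 t1 m0 m01 m10 m1 b0 b01 b10 b1 /\
    pr t0 t01 t10 t1 m0 m01 m10 m1 b0 b01 b10 b1 = e.
Proof.
move=> pr_inj.
have /choice [f fP] : forall s : T * T * T, exists e,
    exists t01 t10 t1 m01 m10 m1 b01 b10 b1,
    cube s.1.1 t01 t10 t1 s.1.2 m01 m10 m1 s.2 b01 b10 b1 /\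
    pr s.1.1 t01 t10 t1 s.1.2 m01 m10 m1 s.2 b01 b10 b1 = e.
  move=> [[t0 m0] b0].
  by have [t01 [t10 [t1 [m01 [m10 [m1 [b01 [b10 [b1 H]]]]]]]]] :=
    cube_ex t0 m0 b0; do 10!eexists; eauto.
have f_inj : injective f.
  move=> [[t0 m0] b0] [[s0 n0] c0] ef.
  have [t01 [t10 [t1 [m01 [m10 [m1 [b01 [b10 [b1 [H1 E1]]]]]]]]]] := fP (t0, m0, b0).
  have [s01 [s10 [s1 [n01 [n10 [n1 [c01 [c10 [c1 [H2 E2]]]]]]]]]] := fP (s0, n0, c0).
  by have [|/= -> -> ->] := pr_inj _ _ _ _ _ _ _ _ _ _ _ _ _ _ _ _ _ _ _ _ _ _ _ _ H1 H2;
    rewrite ?E1 ?E2.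
move=> e; have [s <-] := fin_inj_surj f_inj e.
by have [t01 [t10 [t1 [m01 [m10 [m1 [b01 [b10 [b1 H]]]]]]]]] := fP s;
  do 12!eexists; eauto.
Qed.

(* e and e' tell whether the over- and the under-strand are directed as in
   [xing]: reversing the over-strand exchanges the two under-ends in [xing], and
   reversing the under-strand exchanges the two over-ends. *)
Definition txing (e e' : bool) u o u' o' :=
  xing (if e then u else u') (if e' then o else o')
       (if e then u' else u) (if e' then o' else o).

(* Each choice of orientations makes one side of the move the three faces at some
   vertex of the cube, and the other side the three faces at the opposite one. *)
Lemma cube_fill et em eb t0 t01 t1 m0 m01 m1 b0 b01 b1 :
  txing et em m0 t0 m01 t01 -> txing et eb b0 t01 b01 t1 ->
  txing em eb b01 m01 b1 m1 ->
  exists t10 m10 b10, [/\ txing em eb b0 m0 b10 m10,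
    txing et eb b10 t0 b1 t10 & txing et em m10 t10 m1 t1].
Proof.
(* The three edges at the vertex where the given faces meet, one for each strand: they have to carry
   the inner arcs t01, m01, b01. Any two of them are neighboring ends of a given crossing, so a cube
   with these edges contains all three given crossings. *)
pose pr t0 t01 t10 t1 m0 m01 m10 m1 b0 b01 b10 b1 : T * T * T :=
 (if eb then if em then t01 else t0 else if em then t1 else t10,
  if eb then if et then m01 else m0 else if et then m1 else m10,
  if em then if et then b01 else b0 else if et then b1 else b10).
have [|s0 [s01 [s10 [s1 [n0 [n01 [n10 [n1 [c0 [c01 [c10 [c1 [H]]]]]]]]]]]]] :=
  @cube_at pr _ (t01, m01, b01).
  rewrite /pr => {pr} ? ? ? ? ? ? ? ? ? ? ? ? ? ? ? ? ? ? ? ? ? ? ? ?.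
  move=> [[? ? ?] [? ? ?]] [[? ? ?] [? ? ?]].
  by case: et; case: em; case: eb => -[? ? ?]; subst; saturate.
case: H => -[? ? ?] [? ? ?]; rewrite /pr /txing => {pr}.
by case: et; case: em; case: eb => -[? ? ?] ? ? ?; subst; saturate;
  do 3!eexists; split; eassumption.
Qed.
End CrossingRelation.

(** * Crossings of any type and orientation *)

Section Colorings.
Variable T : finBiquandleType.

Lemma txing_ex e e' (u o : T) : exists u' o', txing e e' u o u' o'.
Proof.
rewrite /txing; case: e e' => -[].
- exact: xing_io.
- by have [x [y H]] := xing_ii_oo u o; exists y, x.
- by have [x [y H]] := xing_uo_oi u o; exists x, y.
- have [x [y H]] := xing_oi u o; exact: (ex_intro _ x (ex_intro _ y H)).
Qed.

Lemma txing_inj e e' (u o u1 o1 u2 o2 : T) :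
  txing e e' u o u1 o1 -> txing e e' u o u2 o2 -> u1 = u2 /\ o1 = o2.
Proof.
rewrite /txing; case: e e' => -[] H1 H2.
- exact: xing_inj_in H1 H2.
- by case: (xing_inj_under_in H1 H2).
- by case: (xing_inj_over_in H1 H2).
- exact: xing_inj_out H1 H2.
Qed.

(* bl, br, tl, tr are the colors of the four corners; o1 and o2 tell whether the
   strands starting at bottom left and at bottom right are directed upwards. *)
Definition crossed (c : crossing) (o1 o2 : bool) (bl br tl tr : T) :=
  match c with
  | Virtual => tl = br /\ tr = bl
  | Classical true => txing o1 o2 br bl tl tr
  | Classical false => txing (~~ o2) (~~ o1) bl br tr tl
  end.

Lemma crossed_ex c o1 o2 (x : T * T) :
  exists t : T * T, crossed c o1 o2 x.1 x.2 t.1 t.2.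
Proof.
case: x => x y /=; case: c => [|[]] /=.
- by exists (y, x).
- by have [a [b H]] := txing_ex o1 o2 y x; exists (a, b).
- by have [a [b H]] := txing_ex (~~ o2) (~~ o1) x y; exists (b, a).
Qed.

(** Chosen rather than computed: when the two strands run in opposite vertical directions, the upper
    colors come from the existential axiom 2 and not from an operation. *)
Definition cross_map c o1 o2 (x : T * T) : T * T := sval (cid (crossed_ex c o1 o2 x)).

Lemma crossP c o1 o2 x y a b :
  crossed c o1 o2 x y a b <-> cross_map c o1 o2 (x, y) = (a, b).
Proof.
rewrite /cross_map; case: cid => -[s s'] /= Hs; split=> [Ht|[<- <-] //].
case: c Hs Ht => [|[]] /=.
- by move=> [-> ->] [-> ->].
- by move=> Hs Ht; have [-> ->] := txing_inj Hs Ht.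
- by move=> Hs Ht; have [-> ->] := txing_inj Hs Ht.
Qed.

(** Reflection in a horizontal line. For a classical crossing both sides unfold to the same [xing];
    stacked, they give Reidemeister II. *)
Lemma crossed_flip c o1 o2 bl br tl tr :
  crossed c o1 o2 bl br tl tr <-> crossed (flip c) o2 o1 tl tr bl br.
Proof. by case: c o1 o2 => [|[]] [] []; split=> // -[]. Qed.

(** Clockwise quarter turn. The strand through bottom left becomes the other diagonal and its
    vertical direction is reversed, whence [flip c] and the negation of b. This is what moves a
    minimum or maximum through a crossing. *)
Lemma crossed_turn c b o bl br tl tr :
  crossed c (~~ b) o bl br tl tr <-> crossed (flip c) o b br tr bl tl.
Proof. by case: c b o => [|[]] [] []; split=> // -[]. Qed.

Lemma cross_flipK c o1 o2 x : cross_map (flip c) o2 o1 (cross_map c o1 o2 x) = x.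
Proof.
case: x => x y; case E: (cross_map c o1 o2 _) => [a b].
by apply/crossP; rewrite -crossed_flip; apply/crossP.
Qed.

(** Reversing all three strands exchanges the two sides of the cube, so this is [cube_fill] read
    backwards. *)
Lemma cube_empty et em eb (t0 t10 t1 m0 m10 m1 b0 b10 b1 : T) :
  txing em eb b0 m0 b10 m10 -> txing et eb b10 t0 b1 t10 ->
  txing et em m10 t10 m1 t1 ->
  exists t01 m01 b01, [/\ txing et em m0 t0 m01 t01,
     txing et eb b0 t01 b01 t1 & txing em eb b01 m01 b1 m1].
Proof.
move=> H1 H2 H3.
have N e e' (u o u' o' : T) :
    txing e e' u o u' o' <-> txing (~~ e) (~~ e') u' o' u o.
  by case: e e' => -[].
have [x [y [z [/N A /N B /N C]]]] :=
  cube_fill (proj1 (N _ _ _ _ _ _) H3) (proj1 (N _ _ _ _ _ _) H2)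
    (proj1 (N _ _ _ _ _ _) H1).
by exists x, y, z; rewrite !negbK in A B C.
Qed.

Local Ltac by_orientation :=
  unfold txing in *; simpl in *;
  repeat match goal with o : bool |- _ => destruct o end; assumption.

(** Non-cyclic over/under data order the strands by height. Each of the six classical cases feeds
    the arcs of the top, middle and bottom strand to the cube, some strands being read downwards;
    the choice between [cube_fill] and [cube_empty] depends on which side of the cube the given
    crossings form. With two or more virtual crossings, colors are only transported. *)
Lemma crossed_braid c12 c13 c23 o1 o2 o3 x1 x2 x3 p q r z1 z2 z3 :
  triple_ok c12 c13 c23 ->
  crossed c12 o1 o2 x1 x2 p q -> crossed c13 o1 o3 q x3 r z3 ->
  crossed c23 o2 o3 p r z1 z2 ->
  exists p' q' r', [/\ crossed c23 o2 o3 x2 x3 p' q',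
    crossed c13 o1 o3 x1 p' z1 r' & crossed c12 o1 o2 r' q' z2 z3].
Proof.
case: c12 c13 c23 => [|[]] [|[]] [|[]] //= _ H1 H2 H3;
  try by repeat match goal with H : _ /\ _ |- _ => destruct H; subst end;
    do 3!eexists; split; eauto.
- have [||| x [y [z [A B C]]]] := @cube_fill T o1 o2 o3 x1 q z3 x2 p z2 x3 r z1;
    try by_orientation.
  by exists z, y, x.
- have [||| x [y [z [A B C]]]] :=
    @cube_fill T o1 (~~ o3) (~~ o2) z3 q x1 x3 r z1 x2 p z2; try by_orientation.
  by exists y, z, x; split; by_orientation.
- have [||| x [y [z [A B C]]]] :=
    @cube_empty (~~ o3) o1 o2 z1 r x3 x1 q z3 x2 p z2; try by_orientation.
  by exists x, z, y; split; by_orientation.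
- have [||| x [y [z [A B C]]]] :=
    @cube_fill T (~~ o2) (~~ o1) o3 x2 p z2 x1 q z3 z1 r x3; try by_orientation.
  by exists z, x, y; split; by_orientation.
- have [||| x [y [z [A B C]]]] :=
    @cube_empty o2 o3 (~~ o1) x2 p z2 x3 r z1 z3 q x1; try by_orientation.
  by exists y, x, z; split; by_orientation.
- have [||| x [y [z [A B C]]]] :=
    @cube_empty (~~ o3) (~~ o2) (~~ o1) x3 r z1 x2 p z2 x1 q z3; try by_orientation.
  by exists x, y, z; split; by_orientation.
Qed.

Lemma crossed_loop_right c o z x y : crossed c o o z x y x -> y = z.
Proof.
case: c o => [|[]] [] //=; rewrite /txing /=; try by [case=> -> ->].
all: by first [move/loop_over|move/loop_under].
Qed.

(** For each color z of the strand exactly one color of the loop is possible, so a kink neither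
    destroys nor multiplies colorings. *)
Lemma crossed_loop_right_ex c o z :
  exists x, crossed c o o z x z x /\ forall x', crossed c o o z x' z x' -> x' = x.
Proof.
case: c o => [|[]] [] /=; rewrite /txing /=; try by [exists z; split=> // ? []].
all: by have [x H] := loop_under_ex z; have [y H'] := loop_over_ex z;
  first [by exists x; split=> // x' /loop_inj_under; apply
        |by exists y; split=> // x' /loop_inj_over; apply].
Qed.

(** * Colorings slice by slice *)

Lemma flatten_map_bind (A B C : Type) (f : A -> seq B) (g : B -> seq C) s :
  flatten [seq g y | y <- flatten [seq f x | x <- s]] =
  flatten [seq flatten [seq g y | y <- f x] | x <- s].
Proof. by elim: s => //= x s IHs; rewrite map_cat flatten_cat IHs. Qed.

(* The orientations and colors of the strands at a level. *)
Definition state := seq (bool * T).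

Definition local_trans (p : piece) (x : state) : seq state :=
  match p, x with
  | Cup b, [::] => [seq [:: (b, t); (~~ b, t)] | t <- enum T]
  | Cap, [:: u; v] => if (u.1 != v.1) && (u.2 == v.2) then [:: [::]] else [::]
  | Cross c, [:: u; v] =>
      let t := cross_map c u.1 v.1 (u.2, v.2) in [:: [:: (v.1, t.1); (u.1, t.2)]]
  | _, _ => [::]
  end.

Definition trans (s : slice) (x : state) : seq state :=
  if s.1 + bottom s.2 <= size x then
    [seq take s.1 x ++ y ++ drop (s.1 + bottom s.2) x
      | y <- local_trans s.2 (take (bottom s.2) (drop s.1 x))]
  else [::].

(* Lists the states reachable from x through w with multiplicity: the number of
   occurrences of y is the number of colorings of w with ends x and y. *)
Fixpoint paths (w : seq slice) (x : state) : seq state :=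
  if w is s :: w' then flatten [seq paths w' y | y <- trans s x] else [:: x].

Lemma paths_cat u v x : paths (u ++ v) x = flatten [seq paths v y | y <- paths u x].
Proof.
elim: u x => [|s u IHu] x /=; first by rewrite cats0.
by rewrite flatten_map_bind; congr flatten; apply: eq_map => y /=; apply: IHu.
Qed.

Lemma local_size p x y : y \in local_trans p x -> size y = top p.
Proof.
case: p => [b||c] /=; case: x => [|u [|v [|? ?]]] //=.
- by case/mapP => t _ ->.
- by case: ifP => // _; rewrite inE => /eqP ->.
- by rewrite inE => /eqP ->.
Qed.

Lemma trans_mid p A B C : size B = bottom p ->
  trans (size A, p) (A ++ B ++ C) = [seq A ++ y ++ C | y <- local_trans p B].
Proof.
move=> sB; rewrite /trans /= !size_cat sB addnA leq_addr -sB.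
by rewrite (take_size_cat _ (erefl (size A))) (drop_size_cat _ (erefl (size A)))
  (take_size_cat _ (erefl (size B))) catA -size_cat drop_size_cat.
Qed.

(** * Locality: words acting on a window of strands *)

Definition shift n (w : seq slice) : seq slice := [seq (s.1 + n, s.2) | s <- w].

Fixpoint fits (w : seq slice) (n : nat) : bool :=
  if w is s :: w' then
    (s.1 + bottom s.2 <= n) && fits w' (n - bottom s.2 + top s.2)
  else true.

Lemma seq_split (A : Type) (s : slice) (x : seq A) : s.1 + bottom s.2 <= size x ->
  exists A B C, [/\ x = A ++ B ++ C, size A = s.1 & size B = bottom s.2].
Proof.
move=> h; exists (take s.1 x), (take (bottom s.2) (drop s.1 x)),
  (drop (bottom s.2) (drop s.1 x)); rewrite !cat_take_drop; split=> //.
- by rewrite size_takel // (leq_trans _ h) ?leq_addr.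
- by rewrite size_takel // size_drop leq_subRL // (leq_trans _ h) ?leq_addr.
Qed.

Lemma trans_size s x y : s.1 + bottom s.2 <= size x -> y \in trans s x ->
  size y = size x - bottom s.2 + top s.2.
Proof.
move=> /seq_split [A [B [C [-> sA sB]]]]; case: s sA sB => i p /= <- sB.
rewrite trans_mid // => /mapP [z /local_size sz ->].
by rewrite !size_cat sz sB; lia.
Qed.

Lemma trans_shift s A x C : s.1 + bottom s.2 <= size x ->
  trans (s.1 + size A, s.2) (A ++ x ++ C) = [seq A ++ y ++ C | y <- trans s x].
Proof.
move=> /seq_split [A' [B [C' [-> sA sB]]]]; case: s sA sB => i p /= <- sB.
rewrite trans_mid // addnC -size_cat -!catA (catA A A') trans_mid // -map_comp.
by apply: eq_map => y /=; rewrite -!catA.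
Qed.

Lemma paths_shift w A x C : fits w (size x) ->
  paths (shift (size A) w) (A ++ x ++ C) = [seq A ++ y ++ C | y <- paths w x].
Proof.
elim: w x => [|s w IHw] x //= /andP [h hw].
rewrite trans_shift // map_flatten -!map_comp; congr flatten.
by apply/eq_in_map => y /= ys; rewrite IHw // (trans_size h ys).
Qed.

Lemma step_mid p (A B C : seq bool) : size B = bottom p ->
  step (size A, p) (A ++ B ++ C) =
  omap (fun y => A ++ y ++ C) (step (0, p) B).
Proof.
move=> sB; rewrite /step !size_cat sB add0n leqnn addnA leq_addr.
case: p B sB => [b||c] [|u [|v []]] //= _.
- by rewrite (take_size_cat _ (erefl (size A))) (drop_size_cat _ (erefl (size A))).
all: rewrite !nth_cat drop_cat ltnn subnn ltnNge leqnSn /= subSnn /=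
  (take_size_cat _ (erefl (size A))) ltnNge -addn2 leq_addr /= addnC addnK /= drop0 //.
by case: ifP.
Qed.

Lemma run_cons s w l : run (s :: w) l = obind (run w) (step s l).
Proof.
rewrite /run /=; case: (step s l) => //=.
by elim: w.
Qed.

Lemma step_size s l l' : step s l = Some l' ->
  s.1 + bottom s.2 <= size l /\ size l' = size l - bottom s.2 + top s.2.
Proof.
case: s => i p /=; case: leqP => // h; case: p h => [b||c] /= h.
- by case=> <-; split => //; rewrite size_cat /= size_take_min size_drop; lia.
- by case: ifP => // _ [<-]; split => //; rewrite size_cat size_take_min size_drop; lia.
- by case=> <-; split => //; rewrite size_cat /= size_take_min size_drop; lia.
Qed.

Lemma step_shift s A (l : seq bool) C : s.1 + bottom s.2 <= size l ->
  step (s.1 + size A, s.2) (A ++ l ++ C) = omap (fun y => A ++ y ++ C) (step s l).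
Proof.
move=> h; have [A' [B [C' [-> sA sB]]]] := seq_split h.
case: s {h} sA sB => i p; rewrite [(i, p).1]/= [(i, p).2]/= => <- sB.
rewrite step_mid // addnC -size_cat -!catA (catA A A') step_mid //.
by case: (step _ B) => //= y; rewrite -!catA.
Qed.

Lemma run_shift w A (l : seq bool) C : fits w (size l) ->
  run (shift (size A) w) (A ++ l ++ C) = omap (fun y => A ++ y ++ C) (run w l).
Proof.
elim: w l => [|s w IHw] l //= /andP [h hw].
rewrite !run_cons step_shift //; case E: (step s l) => [l'|] //=.
by rewrite IHw // (proj2 (step_size E)).
Qed.
End Colorings.

(** * Invariance under the moves *)

Section Moves.
Variable T : finBiquandleType.
Local Notation cross_map := (@cross_map T).
Local Notation paths := (@paths T).

Lemma run_fits w l : run w l -> fits w (size l).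
Proof.
elim: w l => //= s w IHw l; rewrite run_cons; case E: (step s l) => [l'|] //=.
by move=> /IHw; case: (step_size E) => -> ->.
Qed.

(** Reduces a move at position i to position 0 on the k strands that it touches; all others are
    carried along. The [run] hypotheses rule out inadmissible orientations: a zigzag whose minimum
    is directed against the strand has no coloring, while the empty word has one. *)
Lemma perm_paths_shift k i w w' x : fits w k -> fits w' k -> i + k <= size x ->
  (forall y, size y = k -> run w (unzip1 y) -> run w' (unzip1 y) ->
     perm_eq (paths w y) (paths w' y)) ->
  run (shift i w) (unzip1 x) -> run (shift i w') (unzip1 x) ->
  perm_eq (paths (shift i w) x) (paths (shift i w') x).
Proof.
move=> fw fw' ik H.
have [A [B [C [-> <- /= sB]]]] : exists A B C,
  [/\ x = A ++ B ++ C, size A = i & size B = k].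
  exists (take i x), (take k (drop i x)), (drop k (drop i x)).
  by rewrite !cat_take_drop !size_take_min size_drop; split=> //; lia.
rewrite /unzip1 !map_cat -(size_map fst A) !run_shift ?size_map ?sB //.
rewrite !paths_shift ?sB // => rw rw'; apply/perm_map/H => //.
  by case: run rw.
by case: run rw'.
Qed.

Lemma flatten_single (B : Type) (F : T -> seq B) t0 :
  (forall t, t != t0 -> F t = [::]) -> flatten [seq F t | t <- enum T] = F t0.
Proof.
move=> F0; have: t0 \in enum T by rewrite mem_enum.
have := enum_uniq T; elim: (enum T) => //= t s IHs /andP [ts us].
rewrite inE; case: (eqVneq t t0) => [tE _|tt0 /= /IHs ->] //; last by rewrite F0.
subst t.
rewrite (_ : flatten _ = [::]) ?cats0 //.
have : {in s, forall u, F u = [::]}.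
  by move=> u us'; apply: F0; apply: contraNneq ts => <-.
move: s {IHs ts us} => s Fs; elim: s Fs => //= u s IHs Fs.
by rewrite Fs ?inE ?eqxx // IHs // => v vs; apply: Fs; rewrite inE vs orbT.
Qed.

Lemma perm_map_enum (B : eqType) (f g : T -> B) : injective f -> injective g ->
  (forall t, exists t', f t = g t') -> (forall t, exists t', g t = f t') ->
  perm_eq [seq f t | t <- enum T] [seq g t | t <- enum T].
Proof.
move=> fI gI fg gf; apply: uniq_perm; try by rewrite map_inj_uniq ?enum_uniq.
move=> y; apply/mapP/mapP => -[t _ ->].
  by have [t' ->] := fg t; exists t'; rewrite ?mem_enum.
by have [t' ->] := gf t; exists t'; rewrite ?mem_enum.
Qed.

Lemma perm_allpairs_swap (A B : Type) (C : eqType) (f : A -> B -> C) s t :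
  perm_eq [seq f a b | a <- s, b <- t] [seq f a b | b <- t, a <- s].
Proof.
apply/permP => P; rewrite -!sum1_count ![LHS]big_mkcond ![RHS]big_mkcond /=.
by rewrite !big_allpairs_dep exchange_big.
Qed.

Lemma paths_cup A b w C : paths ((size A, Cup b) :: w) (A ++ C) =
  flatten [seq paths w (A ++ (b, t) :: (~~ b, t) :: C) | t <- enum T].
Proof. by rewrite /= (@trans_mid _ (Cup b) A [::] C) //= -!map_comp. Qed.

Lemma paths_zigzag_left b o z : run [:: (0, Cup b); (1, Cap)] [:: o] ->
  paths [:: (0, Cup b); (1, Cap)] [:: (o, z)] = [:: [:: (o, z)]].
Proof.
move=> r; rewrite (paths_cup [::]) (@flatten_single _ _ z) /= /trans /=.
  by rewrite eqxx; case: b o r => -[].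
by move=> t /negPf -> ; rewrite andbF.
Qed.

Lemma paths_zigzag_right b o z : run [:: (1, Cup b); (0, Cap)] [:: o] ->
  paths [:: (1, Cup b); (0, Cap)] [:: (o, z)] = [:: [:: (o, z)]].
Proof.
move=> r; rewrite (paths_cup [:: _] _ _ [::]) (@flatten_single _ _ z) /= /trans /=.
  by rewrite eqxx; case: b o r => -[].
by move=> t; rewrite eq_sym => /negPf -> ; rewrite andbF.
Qed.

Lemma paths_reidemeister1_right b c o z :
  run [:: (1, Cup b); (0, Cross c); (1, Cap)] [:: o] ->
  paths [:: (1, Cup b); (0, Cross c); (1, Cap)] [:: (o, z)] = [:: [:: (o, z)]].
Proof.
move=> r; have -> : b = o by case: b o r => -[].
have [x [Hx x_uniq]] := crossed_loop_right_ex c o z.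
rewrite (paths_cup [:: _] _ _ [::]) (@flatten_single _ _ x) /= /trans /=.
  have -> : cross_map c o o (z, x) = (z, x) by apply/crossP.
  by rewrite eqxx; case: o {r Hx x_uniq}.
(* If the cap can be closed, then t' = t, and [crossed_loop_right] gives y = z; this makes t the
   loop color x. All other t contribute nothing. *)
move=> t; case E: (cross_map c o o (z, t)) => [y t'] /=.
case: (eqVneq t' t) => [tE|_] /=; last by rewrite andbF.
case/eqP; apply: x_uniq; move/crossP: E; rewrite tE /=.
by move=> H; move: (H); rewrite -(crossed_loop_right H).
Qed.

(** Two quarter turns; it carries a kink on the left to one on the right. *)
Lemma crossed_half_turn c o1 o2 (bl br tl tr : T) :
  crossed c o1 o2 bl br tl tr <-> crossed c (~~ o1) (~~ o2) tr tl br bl.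
Proof.
have := crossed_turn c (~~ o1) o2 bl br tl tr; rewrite negbK => ->.
have := crossed_turn (flip c) (~~ o2) (~~ o1) br tr bl tl; rewrite negbK => ->.
by case: c => // -[].
Qed.

Lemma paths_reidemeister1_left b c o z :
  run [:: (0, Cup b); (1, Cross c); (0, Cap)] [:: o] ->
  paths [:: (0, Cup b); (1, Cross c); (0, Cap)] [:: (o, z)] = [:: [:: (o, z)]].
Proof.
move=> r; have -> : b = ~~ o by case: b o r => -[].
have [x [Hx x_uniq]] := crossed_loop_right_ex c (~~ o) z.
rewrite (paths_cup [::]) (@flatten_single _ _ x) /= /trans /= negbK.
  have -> : cross_map c o o (x, z) = (x, z).
    by apply/crossP; rewrite crossed_half_turn.
  by rewrite eqxx; case: o {r Hx x_uniq}.
move=> t; case E: (cross_map c o o (t, z)) => [t' y] /=.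
case: (eqVneq t t') => [tE|_] /=; last by rewrite andbF.
case/eqP; apply: x_uniq; move/crossP: E; rewrite -tE /= crossed_half_turn.
by move=> H; move: (H); rewrite -(crossed_loop_right H).
Qed.

(** Each side has one result for each color of its minimum. The quarter turn pairs the color x on
    one side with the color y on the other so that both give the upper ends x, a, y. *)
Lemma paths_slide_cup b c o z :
  perm_eq (paths [:: (0, Cup b); (1, Cross c)] [:: (o, z)])
          (paths [:: (1, Cup b); (0, Cross (flip c))] [:: (o, z)]).
Proof.
rewrite (paths_cup [::]) (paths_cup [:: _] _ _ [::]) /= /trans /= !flatten_map1.
have turn x y a : cross_map c (~~ b) o (x, z) = (a, y) <->
    cross_map (flip c) o b (z, y) = (x, a).
  by rewrite -!crossP crossed_turn.
apply: perm_map_enum => [x y [] //|x y [] //|x|y].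
  case E: (cross_map c _ _ _) => [a y]; exists y.
  by have := proj1 (turn _ _ _) E => ->.
case E: (cross_map (flip c) _ _ _) => [x a]; exists x.
by have := proj2 (turn _ _ _) E => ->.
Qed.

Lemma paths_slide_cap c u v w :
  perm_eq (paths [:: (1, Cross c); (0, Cap)] [:: u; v; w])
          (paths [:: (0, Cross (flip c)); (1, Cap)] [:: u; v; w]).
Proof.
case: u v w => [o1 x] [o2 y] [o3 z]; rewrite /trans /=.
case E: (cross_map c _ _ _) => [a b]; case E': (cross_map (flip c) _ _ _) => [a' b'].
rewrite /trans /=; case: (eqVneq o1 o3) => //= o13.
have o1E : o1 = ~~ o3 by case: o1 o3 o13 {E E'} => -[].
rewrite {o13}o1E in E' *.
have turn p q r : cross_map c o2 o3 (y, p) = (q, r) <->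
    cross_map (flip c) (~~ o3) o2 (q, y) = (r, p).
  by rewrite -!crossP crossed_turn; case: c {E E'} => [|[]].
case: (eqVneq x a) => [xa|xa].
  by move/turn: E; rewrite -xa E' => -[-> ->]; rewrite eqxx.
case: (eqVneq b' z) => // bz.
by move/turn: E'; rewrite bz E => -[ax]; rewrite ax eqxx in xa.
Qed.

Lemma paths_reidemeister3 c12 c13 c23 u v w : triple_ok c12 c13 c23 ->
  paths [:: (0, Cross c12); (1, Cross c13); (0, Cross c23)] [:: u; v; w] =
  paths [:: (1, Cross c23); (0, Cross c13); (1, Cross c12)] [:: u; v; w].
Proof.
case: u v w => [o1 x1] [o2 x2] [o3 x3] ok; rewrite /= /trans /=.
case E12: (cross_map c12 o1 o2 _) => [p q]; case E13: (cross_map c13 o1 o3 _) => [r z3].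
case E23: (cross_map c23 o2 o3 _) => [z1 z2] /=.
have [p' [q' [r' []]]] := crossed_braid ok (proj2 (crossP _ _ _ _ _ _ _) E12)
  (proj2 (crossP _ _ _ _ _ _ _) E13) (proj2 (crossP _ _ _ _ _ _ _) E23).
by move=> /crossP -> /crossP -> /crossP ->.
Qed.

(** The pieces act on disjoint blocks B and B', separated by the d strands M, so both sides list the
    same pairs of local results; only the order of summation differs. *)
Lemma paths_far_exchange i d p q x :
  fits [:: (i, p); (i + top p + d, q)] (size x) ->
  fits [:: (i + bottom p + d, q); (i, p)] (size x) ->
  perm_eq (paths [:: (i, p); (i + top p + d, q)] x)
          (paths [:: (i + bottom p + d, q); (i, p)] x).
Proof.
move=> /and3P [f1 f2 _] /and3P [f3 f4 _]; rewrite /= in f1 f2 f3 f4.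
have [A [B [M [B' [C [xE sA sB sM sB']]]]]] : exists A B M B' C,
  [/\ x = A ++ B ++ M ++ B' ++ C, size A = i, size B = bottom p,
      size M = d & size B' = bottom q].
  exists (take i x), (take (bottom p) (drop i x)),
    (take d (drop (i + bottom p) x)),
    (take (bottom q) (drop (i + bottom p + d) x)),
    (drop (i + bottom p + d + bottom q) x).
  rewrite ![_ + bottom q]addnC ![_ + d]addnC ![i + _]addnC -!drop_drop !cat_take_drop.
  by rewrite !size_take_min !size_drop; split=> //; lia.
rewrite {}xE {f1 f2 f3 f4} -sA -sM; pose g y y' := A ++ y ++ M ++ y' ++ C.
have -> : paths [:: (size A, p); (size A + top p + size M, q)]
    (A ++ B ++ M ++ B' ++ C) =
    [seq g y y' | y <- local_trans p B, y' <- local_trans q B'].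
  rewrite /= trans_mid // -map_comp; congr flatten.
  apply/eq_in_map => y /local_size sy /=.
  rewrite flatten_map1 map_id -sy -!size_cat.
  by rewrite !catA -[_ ++ C]catA trans_mid //; apply: eq_map => y'; rewrite /g -!catA.
have -> : paths [:: (size A + bottom p + size M, q); (size A, p)]
    (A ++ B ++ M ++ B' ++ C) =
    [seq g y y' | y' <- local_trans q B', y <- local_trans p B].
  rewrite -sB -!size_cat !catA -[_ ++ C]catA /= trans_mid // -map_comp; congr flatten.
  apply: eq_map => y' /=.
  by rewrite flatten_map1 map_id -!catA trans_mid.
exact: perm_allpairs_swap.
Qed.

Lemma paths_move w w' x : move w w' -> run w (unzip1 x) -> run w' (unzip1 x) ->
  perm_eq (paths w x) (paths w' x).
Proof.
move=> m rw rw'; have := run_fits rw; have := run_fits rw'.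
rewrite size_map; case: m rw rw' => [i d p q|i b|i b|i b c|i c|i b c|i b c|i c|].
- by move=> _ _ f' f; apply: paths_far_exchange.
- move=> rw rw' _ /= f.
  apply: (@perm_paths_shift 1 i [:: (0, Cup b); (1, Cap)] [::]) => //; first lia.
  by move=> [|[o z] []] // _ r _; rewrite paths_zigzag_left.
- move=> rw rw' _ /= f.
  apply: (@perm_paths_shift 1 i [:: (1, Cup b); (0, Cap)] [::]) => //; first lia.
  by move=> [|[o z] []] // _ r _; rewrite paths_zigzag_right.
- move=> rw rw' _ /= f.
  apply: (@perm_paths_shift 1 i [:: (0, Cup b); (1, Cross c)]
    [:: (1, Cup b); (0, Cross (flip c))]) => //; first lia.
  by move=> [|[o z] []] // _ _ _; apply: paths_slide_cup.
- move=> rw rw' _ /= f.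
  apply: (@perm_paths_shift 3 i [:: (1, Cross c); (0, Cap)]
    [:: (0, Cross (flip c)); (1, Cap)]) => //; first lia.
  by move=> [|u [|v [|w1 []]]] // _ _ _; apply: paths_slide_cap.
- move=> rw rw' _ /= f.
  apply: (@perm_paths_shift 1 i [:: (1, Cup b); (0, Cross c); (1, Cap)] [::]) => //.
    lia.
  by move=> [|[o z] []] // _ r _; rewrite paths_reidemeister1_right.
- move=> rw rw' _ /= f.
  apply: (@perm_paths_shift 1 i [:: (0, Cup b); (1, Cross c); (0, Cap)] [::]) => //.
    lia.
  by move=> [|[o z] []] // _ r _; rewrite paths_reidemeister1_left.
- move=> rw rw' _ /= f.
  apply: (@perm_paths_shift 2 i [:: (0, Cross c); (0, Cross (flip c))] [::]) => //.
    lia.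
  by move=> [|[o1 z1] [|[o2 z2] []]] // _ _ _;
    rewrite /trans /= -surjective_pairing cross_flipK.
- move=> i c12 c13 c23 ok rw rw' _ /= f.
  apply: (@perm_paths_shift 3 i [:: (0, Cross c12); (1, Cross c13); (0, Cross c23)]
    [:: (1, Cross c23); (0, Cross c13); (1, Cross c12)]) => //; first lia.
  by move=> [|u [|v [|w1 []]]] // _ _ _; rewrite paths_reidemeister3.
Qed.

Lemma trans_step s (x y : state T) : y \in trans s x -> step s (unzip1 x) = Some (unzip1 y).
Proof.
have [/seq_split|/negPf h] := boolP (s.1 + bottom s.2 <= size x); last first.
  by rewrite /trans h.
case: s => i p [A [B [C [-> ]]]]; rewrite [(i, p).1]/= [(i, p).2]/= => <- sB.
rewrite trans_mid //.
case/mapP => z zB ->; rewrite /unzip1 !map_cat -(size_map fst A) step_mid ?size_map //.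
case: p B sB zB => [b||c] [|[o u] [|[o' v] []]] //= _.
- by case/mapP => t _ ->.
- by case: ifP => // /andP [-> _]; rewrite inE => /eqP ->.
- by rewrite inE => /eqP ->.
Qed.

Lemma paths_run w (x y : state T) : y \in paths w x -> run w (unzip1 x) = Some (unzip1 y).
Proof.
elim: w x => [|s w IHw] x /=; first by rewrite inE => /eqP ->.
rewrite run_cons => /flatten_mapP [z /trans_step -> /IHw //].
Qed.

Lemma run_cat u v l : run (u ++ v) l = obind (run v) (run u l).
Proof.
elim: u l => //= s u IHu l; rewrite !run_cons.
by case: (step s l) => //=.
Qed.

Lemma perm_flatten_map (A : eqType) (B : eqType) (f g : A -> seq B) (s t : seq A) :
  perm_eq s t -> {in s, forall x, perm_eq (f x) (g x)} ->
  perm_eq (flatten [seq f x | x <- s]) (flatten [seq g x | x <- t]).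
Proof.
move=> st fg; apply: (@perm_trans _ (flatten [seq g x | x <- s])); last first.
  by apply/perm_flatten/perm_map.
elim: s {st} fg => //= x s IHs fg; apply: perm_cat; first by rewrite fg ?inE ?eqxx.
by apply: IHs => y ys; apply: fg; rewrite inE ys orbT.
Qed.

Lemma paths_diagram_move D D' : diagram_move D D' ->
  size (paths D [::]) = size (paths D' [::]).
Proof.
case: D D' => D rD [D' rD'] [u [v [w [w' /= [m DE D'E]]]]].
subst; apply: perm_size; rewrite !paths_cat; apply: perm_flatten_map => // x xu.
rewrite !paths_cat; apply: perm_flatten_map => //.
have xr := paths_run xu; move: rD rD'; rewrite !run_cat xr /= !run_cat.
(* Both diagrams close up, so both sides of the move are admissible at the level reached through
   u. *)
by case r: (run w _) => //= _; case r': (run w' _) => //= _;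
  apply: paths_move; rewrite ?r ?r'.
Qed.

Lemma paths_isotopic D D' : virtually_isotopic D D' ->
  size (paths D [::]) = size (paths D' [::]).
Proof.
by elim=> [x y|x|x y _ ->|x y z _ -> _ ->] //; apply: paths_diagram_move.
Qed.
End Moves.

(** * Homomorphisms from a presented biquandle *)

Section PresentedHom.
Variable T : finBiquandleType.

Lemma upb_inj (b : T) : injective (upb^~ b).
Proof.
apply: fin_surj_inj => a; have [x [_ [[_ [ex _]] _]]] := bq2 a b.
by exists x.
Qed.

Lemma dnb_inj (a : T) : injective (dnb^~ a).
Proof.
apply: fin_surj_inj => b; have [_ [y [_ [_ [_ ey]]]]] := bq2 a b.
by exists (dn b y).
Qed.

(** Any choice of witnesses for axioms 2 and 4 makes [eval] respect the generated equivalence;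
    finiteness is needed only for uniqueness, in [hom_ext]. *)
Definition opX (a b : T) : T := sval (cid (bq2 a b)).
Definition opY (a b : T) : T := sval (cid (svalP (cid (bq2 a b)))).
Definition opFx (a : T) : T := sval (cid (bq4 a)).
Definition opFy (a : T) : T := sval (cid (svalP (cid (bq4 a)))).

Fixpoint eval (X : Type) (g : X -> T) (w : word X) : T :=
  match w with
  | Gen x => g x
  | Wup u v => up (eval g u) (eval g v)
  | Wupb u v => upb (eval g u) (eval g v)
  | Wdn u v => dn (eval g u) (eval g v)
  | Wdnb u v => dnb (eval g u) (eval g v)
  | WX u v => opX (eval g u) (eval g v)
  | WY u v => opY (eval g u) (eval g v)
  | WFx u => opFx (eval g u)
  | WFy u => opFy (eval g u)
  end.

Section Presentation.
Variable P : presentation.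

Lemma eval_equiv (g : gens P -> T) :
  (forall u v, (u, v) \in rels P -> eval g u = eval g v) ->
  forall u v, word_equiv u v -> eval g u = eval g v.
Proof.
move=> gP u v.
have X (a b : T) := svalP (cid (svalP (cid (bq2 a b)))).
have F (a : T) := svalP (cid (svalP (cid (bq4 a)))).
elim=> /=; [exact: gP|..]; try by move=> *; congruence.
- by move=> *; exact: bq1_i.
- by move=> *; exact: bq1_ii.
- by move=> *; exact: bq1_iii.
- by move=> *; exact: bq1_iv.
- by move=> a b; case: (X (eval g a) (eval g b)) => -[? [? ?]] [? [? ?]].
- by move=> a b; case: (X (eval g a) (eval g b)) => -[? [? ?]] [? [? ?]].
- by move=> a b; case: (X (eval g a) (eval g b)) => -[? [? ?]] [? [? ?]].
- by move=> a b; case: (X (eval g a) (eval g b)) => -[? [? ?]] [? [? ?]].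
- by move=> a b; case: (X (eval g a) (eval g b)) => -[? [? ?]] [? [? ?]].
- by move=> a b; case: (X (eval g a) (eval g b)) => -[? [? ?]] [? [? ?]].
- by move=> *; exact: bq3_i.
- by move=> *; exact: bq3_ii.
- by move=> *; exact: bq3_iii.
- by move=> *; exact: bq3_iv.
- by move=> *; exact: bq3_v.
- by move=> *; exact: bq3_vi.
- by move=> a; case: (F (eval g a)) => -[? ?] [? ?].
- by move=> a; case: (F (eval g a)) => -[? ?] [? ?].
- by move=> a; case: (F (eval g a)) => -[? ?] [? ?].
- by move=> a; case: (F (eval g a)) => -[? ?] [? ?].
Qed.

Local Notation cls := (\pi_(presented P))%qT.

Lemma repr_cls (u : word (gens P)) : word_equiv (repr (cls u)) u.
Proof. by apply/presented_eqP; rewrite reprK. Qed.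

Lemma hom_extend (g : gens P -> T) :
  (forall u v, (u, v) \in rels P -> eval g u = eval g v) ->
  exists2 phi : presented P -> T, is_hom phi & forall x, phi (cls (Gen x)) = g x.
Proof.
move=> gP; exists (fun a => eval g (repr a)); last first.
  by move=> x; rewrite (eval_equiv gP (repr_cls _)).
by split=> a b; rewrite (eval_equiv gP (repr_cls _)).
Qed.

Lemma cls_ops (u v : word (gens P)) :
  [/\ up (cls u) (cls v) = cls (Wup u v), upb (cls u) (cls v) = cls (Wupb u v),
      dn (cls u) (cls v) = cls (Wdn u v) & dnb (cls u) (cls v) = cls (Wdnb u v)].
Proof.
split; apply/presented_eqP; [apply: we_up|apply: we_upb|apply: we_dn|apply: we_dnb];
  exact: repr_cls.
Qed.

Lemma hom_cls (phi : presented P -> T) : is_hom phi -> forall u v,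
  [/\ phi (cls (Wup u v)) = up (phi (cls u)) (phi (cls v)),
      phi (cls (Wupb u v)) = upb (phi (cls u)) (phi (cls v)),
      phi (cls (Wdn u v)) = dn (phi (cls u)) (phi (cls v)) &
      phi (cls (Wdnb u v)) = dnb (phi (cls u)) (phi (cls v))].
Proof.
move=> [h1 h2 h3 h4] u v; have [<- <- <- <-] := cls_ops u v.
by split.
Qed.

(** Homomorphisms are only required to preserve the four operations. At the words [WX], [WY], [WFx]
    and [WFy] the values are forced by cancelling an injective operation of T in axioms 2 (ii), 2
    (v), 4 (ii) and 4 (iv). *)
Lemma hom_ext (phi psi : presented P -> T) : is_hom phi -> is_hom psi ->
  (forall x, phi (cls (Gen x)) = psi (cls (Gen x))) -> phi = psi.
Proof.
move=> hphi hpsi eq_gen; apply/funext => a; rewrite -(reprK a).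
have E u v : word_equiv u v -> cls u = cls v by move/presented_eqP.
elim: (repr a) => [x|u IHu v IHv|u IHu v IHv|u IHu v IHv|u IHu v IHv
                  |u IHu v IHv|u IHu v IHv|u IHu|u IHu] //.
- by have [-> _ _ _] := hom_cls hphi u v; have [-> _ _ _] := hom_cls hpsi u v;
  rewrite IHu IHv.
- by have [_ -> _ _] := hom_cls hphi u v; have [_ -> _ _] := hom_cls hpsi u v;
  rewrite IHu IHv.
- by have [_ _ -> _] := hom_cls hphi u v; have [_ _ -> _] := hom_cls hpsi u v;
  rewrite IHu IHv.
- by have [_ _ _ ->] := hom_cls hphi u v; have [_ _ _ ->] := hom_cls hpsi u v;
  rewrite IHu IHv.
- apply: (@upb_inj (phi (cls v))) => /=; have e := E _ _ (we_2_ii u v).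
  have [_ <- _ _] := hom_cls hphi (WX u v) v; rewrite IHv.
  by have [_ <- _ _] := hom_cls hpsi (WX u v) v; rewrite -e.
- apply: (@up_inj _ (phi (cls v))) => /=; have e := E _ _ (we_2_v u v).
  have [<- _ _ _] := hom_cls hphi (WY u v) v; rewrite IHv.
  by have [<- _ _ _] := hom_cls hpsi (WY u v) v; rewrite -e.
- apply: (@up_inj _ (phi (cls u))) => /=; have e := E _ _ (we_4_ii u).
  have [<- _ _ _] := hom_cls hphi (WFx u) u; rewrite IHu.
  by have [<- _ _ _] := hom_cls hpsi (WFx u) u; rewrite -e.
- apply: (@dnb_inj (phi (cls u))) => /=; have e := E _ _ (we_4_iv u).
  have [_ _ _ <-] := hom_cls hphi (WFy u) u; rewrite IHu.
  by have [_ _ _ <-] := hom_cls hpsi (WFy u) u; rewrite -e.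
Qed.
End Presentation.
End PresentedHom.

(** * Colorings of a diagram *)

Section Trajectories.
Variable T : finBiquandleType.

(** The counterpart of [paths] that records all intermediate levels: colorings become the entries of
    a duplicate-free list instead of multiplicities. *)
Fixpoint trajs (w : seq slice) (x : state T) : seq (seq (state T)) :=
  if w is s :: w' then flatten [seq [seq x :: h | h <- trajs w' y] | y <- trans s x]
  else [:: [:: x]].

Lemma size_trajs w x : size (trajs w x) = size (paths w x).
Proof.
elim: w x => //= s w IHw x; rewrite !size_flatten; congr sumn.
by rewrite /shape -!map_comp; apply: eq_map => y /=; rewrite size_map IHw.
Qed.

Lemma local_uniq p (x : state T) : uniq (local_trans p x).
Proof.
case: p x => [b||c] [|u [|v []]] //=; last by case: ifP.
by rewrite map_inj_uniq ?enum_uniq // => t t' [].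
Qed.

Lemma trans_uniq s (x : state T) : uniq (trans s x).
Proof.
rewrite /trans; case: ifP => // _; rewrite map_inj_in_uniq ?local_uniq //.
move=> y z /local_size sy /local_size sz /eqP; rewrite eqseq_cat // eqxx /=.
by rewrite eqseq_cat ?sy ?sz // => /andP [/eqP].
Qed.

Lemma trajs_head w x h : h \in trajs w x -> head [::] h = x.
Proof.
case: w => [|s w] /=; first by rewrite inE => /eqP ->.
by case/flatten_mapP => y _ /mapP [? _ ->].
Qed.

Lemma trajs_uniq w x : uniq (trajs w x).
Proof.
elim: w x => //= s w IHw x.
elim: (trans s x) (trans_uniq s x) => //= y r IHr /andP [yr ur].
rewrite cat_uniq IHr // andbT map_inj_uniq ?IHw /=; last by move=> ? ? [].
apply/hasPn => h /flatten_mapP [z zr /mapP [h1 h1z ->]].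
apply/mapP => -[h2 h2y [E]]; subst h2.
by move: yr; rewrite -(trajs_head h2y) (trajs_head h1z) zr.
Qed.

Lemma trajsP w x h : reflect
  [/\ size h = (size w).+1, nth [::] h 0 = x &
   forall j, j < size w -> nth [::] h j.+1 \in trans (nth (0, Cap) w j) (nth [::] h j)]
  (h \in trajs w x).
Proof.
apply: (iffP idP).
  elim: w x h => [|s w IHw] x h /=; first by rewrite inE => /eqP ->.
  case/flatten_mapP => y ys /mapP [h' h'y ->]; have [sh h0 hS] := IHw _ _ h'y.
  split=> //=; first by rewrite sh.
  by case=> [|j] jw /=; [rewrite h0|exact: hS].
elim: w x h => [|s w IHw] x [|y h] [] //=.
  by case: h => // _ -> _; rewrite inE.
move=> [sh] <- hS; apply/flatten_mapP; exists (nth [::] h 0).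
  by have := hS 0 isT.
apply: map_f; apply: IHw; split=> // j jw; exact: (hS j.+1).
Qed.

(* t0 is a junk value for k out of range. *)
Definition color (t0 : T) (x : state T) k := (nth (true, t0) x k).2.

Lemma eq_state t0 (x y : state T) : unzip1 x = unzip1 y ->
  (forall k, k < size x -> color t0 x k = color t0 y k) -> x = y.
Proof.
move=> e1 e2; have sxy : size x = size y.
  by rewrite -(size_map fst) -/(unzip1 x) e1 size_map.
apply: (@eq_from_nth _ (true, t0)) => // k kx.
rewrite (surjective_pairing (nth _ x k)) (surjective_pairing (nth _ y k)).
congr pair; last exact: e2.
by rewrite -!(nth_map _ true fst) -?sxy // -/(unzip1 x) e1.
Qed.

Lemma color_cat t0 (x y : state T) k :
  color t0 (x ++ y) k = if k < size x then color t0 x k else color t0 y (k - size x).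
Proof. by rewrite /color nth_cat; case: ifP. Qed.

Lemma map_cat_inv (X Y : Type) (f : X -> Y) s a b : map f s = a ++ b ->
  exists s1 s2, [/\ s = s1 ++ s2, map f s1 = a & map f s2 = b].
Proof.
move=> e; exists (take (size a) s), (drop (size a) s).
by rewrite cat_take_drop map_take map_drop e take_size_cat ?drop_size_cat.
Qed.

(** The tails C and C' stand for the strands to the right of the piece, so that the conditions have
    the form met in [transP] once the left strands are removed. *)
Lemma localP t0 p (x y : state T) C C' : step (0, p) (unzip1 x) = Some (unzip1 y) ->
  size x = bottom p -> y \in local_trans p x <->
  match p with
  | Cup _ => color t0 (y ++ C') 0 = color t0 (y ++ C') 1
  | Cap => color t0 (x ++ C) 0 = color t0 (x ++ C) 1
  | Cross c => crossed c (nth true (unzip1 (x ++ C)) 0) (nth true (unzip1 (x ++ C)) 1)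
      (color t0 (x ++ C) 0) (color t0 (x ++ C) 1)
      (color t0 (y ++ C') 0) (color t0 (y ++ C') 1)
  end.
Proof.
case: p x => [b||c] [|[o u] [|[o' v] []]] // st _.
- case: y st => [|[b1 t] [|[b2 t'] []]] //= [<- <-]; rewrite /color /=.
  split=> [/mapP [t2 _ [-> ->]] //|->]; apply/mapP; exists t' => //.
  by rewrite mem_enum.
- case: y st => [|? ?]; last by case: o o' => -[].
  rewrite /color /=; case: o o' => -[] //= _;
    by split=> [|->]; [case: eqP|rewrite eqxx].
- case: y st => [|[b1 t] [|[b2 t'] []]] //= [<- <-]; rewrite /color /=.
  rewrite crossP inE; case: (cross_map _ _ _ _) => a b /=.
  by split=> [/eqP [-> ->]|[-> ->]].
Qed.

(** The clauses treat the strands to the left, those to the right and the piece itself, as in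
    [joined_in]. *)
Lemma transP t0 i p (x y : state T) : step (i, p) (unzip1 x) = Some (unzip1 y) ->
  y \in trans (i, p) x <->
  [/\ forall k, k < i -> color t0 x k = color t0 y k,
      forall k k', k < size x -> i + bottom p <= k -> k' + bottom p = k + top p ->
        color t0 x k = color t0 y k' &
      match p with
      | Cup _ => color t0 y i = color t0 y i.+1
      | Cap => color t0 x i = color t0 x i.+1
      | Cross c => crossed c (nth true (unzip1 x) i) (nth true (unzip1 x) i.+1)
          (color t0 x i) (color t0 x i.+1) (color t0 y i) (color t0 y i.+1)
      end].
Proof.
move=> st; have [] := step_size st; rewrite size_map /=.
move=> /(@seq_split _ (i, p)) [A [B [C [xE]]]]; rewrite {}xE in st *.
rewrite [(i, p).1]/= [(i, p).2]/= => iE sB _; rewrite -{}iE in st *.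
rewrite trans_mid //.
move: st; rewrite {1}/unzip1 !map_cat -(size_map fst A) step_mid ?size_map //.
case E: (step _ _) => [l|] //= [/esym yE].
have [A1 [y' [{yE}-> A1A yE]]] := map_cat_inv yE.
have [B1 [C1 [{yE}-> B1l C1C]]] := map_cat_inv yE.
rewrite -{}B1l in E.
have sA : size A1 = size A by rewrite -(size_map fst A) -A1A size_map.
have sC : size C1 = size C by rewrite -(size_map fst C) -C1C size_map.
have sB1 : size B1 = top p.
  by have [] := step_size E; rewrite !size_map sB /=; lia.
have -> : A1 ++ B1 ++ C1 \in [seq A ++ y ++ C | y <- local_trans p B] <->
    [/\ A = A1, C = C1 & B1 \in local_trans p B].
  split=> [/mapP [z zB /eqP]|[<- <- H]]; last by apply/mapP; exists B1.
  rewrite !eqseq_cat ?(local_size zB) // => /and3P [/eqP -> /eqP -> /eqP ->].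
  by [].
have colorA k : color t0 (A ++ B ++ C) (size A + k) = color t0 (B ++ C) k.
  by rewrite color_cat ltnNge leq_addr addKn.
have colorA1 k : color t0 (A1 ++ B1 ++ C1) (size A + k) = color t0 (B1 ++ C1) k.
  by rewrite -sA color_cat ltnNge leq_addr addKn.
have nthA k : nth true (unzip1 (A ++ B ++ C)) (size A + k) = nth true (unzip1 (B ++ C)) k.
  by rewrite /unzip1 map_cat nth_cat size_map ltnNge leq_addr addKn.
move: (colorA 0) (colorA 1) (colorA1 0) (colorA1 1) (nthA 0) (nthA 1).
rewrite addn0 addn1 => -> -> -> -> -> ->.
have := localP t0 C C1 E sB.
set third := (X in _ <-> X) => H3.
split=> [[AA1 CC1 /H3 B1in]|[e1 e2 /H3 B1in]].
  split=> // [k kA|k k' kx k1 k2].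
    by rewrite !color_cat kA -AA1 kA.
  have -> : k = size A + (size B + (k - size A - size B)) by lia.
  have -> : k' = size A + (size B1 + (k - size A - size B)) by lia.
  rewrite colorA colorA1 !color_cat !(ltnNge (_ + _)) !leq_addr /= !addKn.
  by rewrite CC1.
split=> //; apply: (@eq_state t0) => // k kA.
  by have := e1 k kA; rewrite !color_cat sA kA.
have := e2 (size A + (size B + k)) (size A + (size B1 + k)).
rewrite colorA colorA1 !color_cat !(ltnNge (_ + _)) !leq_addr /= !addKn.
by apply; rewrite ?size_cat; lia.
Qed.
End Trajectories.

(** * Colorings of points, trajectories and homomorphisms *)

Section Diagram.
Variable T : finBiquandleType.
Variable D : diagram.
Implicit Types (x y : Defs.point D) (c : Defs.point D -> T).

Lemma run_level j : j <= size D -> run (take j D) [::] = Some (level D j).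
Proof.
move=> jD; rewrite /level; have := diagramP D.
rewrite -{1}(cat_take_drop j D) run_cat.
by case: (run (take j D) [::]).
Qed.

Lemma step_level j : j < size D ->
  step (nth (0, Cap) D j) (level D j) = Some (level D j.+1).
Proof.
move=> jD; have := run_level jD; rewrite (take_nth (0, Cap)) // -cats1 run_cat.
by rewrite run_level ?(ltnW jD) //= run_cons; case: (step _ _).
Qed.

Lemma locP j k : j <= size D -> k < size (level D j) -> exists x, loc x = (j, k).
Proof.
move=> jD kl; pose j' : 'I_(size D).+1 := Ordinal (jD : j < (size D).+1).
by exists (existT (fun j : 'I_(size D).+1 => 'I_(size (level D j))) j'
  (Ordinal (kl : k < size (level D j')))).
Qed.

Lemma loc_bound x : (loc x).1 <= size D /\ (loc x).2 < size (level D (loc x).1).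
Proof. by case: x => j k /=; split; [rewrite -ltnS|]. Qed.

Definition crossing_colors (pos : bool) (ui oi uo oo : T) :=
  if pos then uo = up ui oi /\ oo = dn oi ui else uo = upb ui oi /\ oo = dnb oi ui.

Definition coloring c :=
  (forall x y, joined x y -> c x = c y) /\
  (forall pos ui oi uo oo, @crossing_ends D (pos, (ui, oi), (uo, oo)) ->
     crossing_colors pos (c ui) (c oi) (c uo) (c oo)).

(* The inbound and outbound ends of the under-strand, then of the over-strand. *)
Definition ends (X : Type) (a_up b_up a_over : bool) (bl br tl tr : X) :
    (X * X) * (X * X) :=
  let a := if a_up then (bl, tr) else (tr, bl) in
  let b := if b_up then (br, tl) else (tl, br) in
  (if a_over then b else a, if a_over then a else b).

Lemma ends_map (X Y : Type) (f : X -> Y) a_up b_up a_over bl br tl tr :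
  let e := ends a_up b_up a_over bl br tl tr in
  ends a_up b_up a_over (f bl) (f br) (f tl) (f tr) =
  ((f e.1.1, f e.1.2), (f e.2.1, f e.2.2)).
Proof. by case: a_up b_up a_over => -[] []. Qed.

Lemma crossed_ends a_over a_up b_up (bl br tl tr : T) :
  crossed (Classical a_over) a_up b_up bl br tl tr <->
  let e := ends a_up b_up a_over bl br tl tr in
  crossing_colors (a_over == (a_up == b_up)) e.1.1 e.2.1 e.1.2 e.2.2.
Proof.
by case: a_over a_up b_up => -[] []; rewrite /crossing_colors /= ?xing_neg; split.
Qed.

(** Extending c to all pairs of numbers avoids the dependent type of points and brings the
    conditions to the form of [transP]. *)
Lemma coloringP c (V : nat * nat -> T) : (forall x, c x = V (loc x)) ->
  coloring c <->
  (forall j, j < size D -> let: (i, p) := nth (0, Cap) D j in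
    [/\ forall k, k < i -> V (j, k) = V (j.+1, k),
      forall k k', k < size (level D j) -> i + bottom p <= k ->
        k' + bottom p = k + top p -> V (j, k) = V (j.+1, k') &
      match p with
      | Cup _ => V (j.+1, i) = V (j.+1, i.+1)
      | Cap => V (j, i) = V (j, i.+1)
      | Cross cr => crossed cr (nth true (level D j) i) (nth true (level D j) i.+1)
          (V (j, i)) (V (j, i.+1)) (V (j.+1, i)) (V (j.+1, i.+1))
      end]).
Proof.
move=> cV; split.
- move=> [cJ cX] j jD; case s: (nth _ _ _) => [i p].
  have st := step_level jD; rewrite s in st.
  have [/= ib sl] := step_size st; rewrite [bottom (_, _).2]/= [top (_, _).2]/= in sl.
  have Vj x y : joined_in j (i, p) (loc x) (loc y) -> V (loc x) = V (loc y).
    move=> xy; rewrite -!cV; apply: cJ; apply/existsP; exists (Ordinal jD).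
    by rewrite /= s xy.
  split.
  + move=> k ki.
    have [x xE] : exists x, loc x = (j, k) by apply: locP; lia.
    have [y yE] : exists y, loc y = (j.+1, k) by apply: locP; lia.
    by rewrite -xE -yE; apply: Vj; rewrite xE yE /= !eqxx ki.
  + move=> k k' kx k1 k2.
    have [x xE] : exists x, loc x = (j, k) by apply: locP; lia.
    have [y yE] : exists y, loc y = (j.+1, k') by apply: locP; lia.
    by rewrite -xE -yE; apply: Vj; rewrite xE yE /= !eqxx k1 k2 eqxx orbT.
  + have L k : k < bottom p -> exists x, loc x = (j, i + k) by move=> ?; apply: locP; lia.
    have U k : k < top p -> exists x, loc x = (j.+1, i + k) by move=> ?; apply: locP; lia.
    case: p s st ib sl Vj L U => [b||[|a_over]] s st ib sl Vj L U.
    * have [x] := U 0 isT; have [y] := U 1 isT; rewrite addn0 addn1 => yE xE.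
      by rewrite -xE -yE; apply: Vj; rewrite xE yE /= !eqxx !orbT.
    * have [x] := L 0 isT; have [y] := L 1 isT; rewrite addn0 addn1 => yE xE.
      by rewrite -xE -yE; apply: Vj; rewrite xE yE /= !eqxx !orbT.
    * have [x] := L 0 isT; have [y] := L 1 isT; rewrite addn0 addn1 => yE xE.
      have [z] := U 0 isT; have [t] := U 1 isT; rewrite addn0 addn1 => tE zE.
      by rewrite -xE -yE -zE -tE; split; apply/esym/Vj;
        rewrite ?xE ?yE ?zE ?tE /= !eqxx ?orbT.
    * have [x] := L 0 isT; have [y] := L 1 isT; rewrite addn0 addn1 => yE xE.
      have [z] := U 0 isT; have [t] := U 1 isT; rewrite addn0 addn1 => tE zE.
      apply/crossed_ends => e.
      set a_up := nth _ _ i in e *; set b_up := nth _ _ i.+1 in e *.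
      pose q := ends a_up b_up a_over x y z t.
      have := cX (a_over == (a_up == b_up)) q.1.1 q.2.1 q.1.2 q.2.2.
      have -> : e = ((c q.1.1, c q.1.2), (c q.2.1, c q.2.2)).
        by rewrite -ends_map /e -xE -yE -zE -tE -!cV.
      apply; apply/existsP; exists (Ordinal jD); rewrite /= s eqxx /=.
      have := ends_map (@loc D) a_up b_up a_over x y z t.
      by rewrite xE yE zE tE => -[-> ->]; rewrite !eqxx.
- move=> H.
  have cJ x y (j : 'I_(size D)) :
      joined_in j (nth (0, Cap) D j) (loc x) (loc y) -> c x = c y.
    have := H j (ltn_ord j); rewrite !cV.
    have := loc_bound x; case: (loc x) => jx kx /= [_]; case: (loc y) => jy ky.
    case: (nth _ _ _) => i p bx [h1 h2 h3] /= /or3P [].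
    + by move=> /and4P [/eqP jxE /eqP -> ki /eqP ->]; rewrite jxE h1.
    + move=> /and4P [/eqP jxE /eqP -> ki /eqP e]; subst jx.
      exact: h2.
    + case: p h3 {h1 h2} => [b||[|a_over]] h3 //.
      * by move=> /andP [/eqP [-> ->] /eqP [-> ->]].
      * by move=> /andP [/eqP [-> ->] /eqP [-> ->]].
      * by case: h3 => e1 e2 /orP [] /andP [/eqP [-> ->] /eqP [-> ->]].
  split.
  + by move=> x y /existsP [j /orP [/cJ //|/cJ ->]].
  + move=> pos ui oi uo oo /existsP [j].
    have := H j (ltn_ord j); case: (nth _ _ _) => i [b||[|a_over]] // [_ _].
    rewrite !cV; set a_up := nth _ _ i; set b_up := nth _ _ i.+1.
    move=> /crossed_ends; rewrite (ends_map V); set e := ends _ _ _ _ _ _ _.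
    move=> h /and3P [/eqP -> /eqP hu /eqP ho].
    have : (loc ui, loc uo) = e.1 by rewrite hu.
    have : (loc oi, loc oo) = e.2 by rewrite ho.
    by case: e h {hu ho} => -[? ?] [? ?] h [-> ->] [-> ->].
Qed.

(** Since T may be empty, no default color is fixed; at the location of a point the color read does
    not depend on t0. *)
Definition shows (h : seq (state T)) c :=
  [/\ size h = (size D).+1,
      forall j, j <= size D -> unzip1 (nth [::] h j) = level D j &
      forall t0 x, c x = color t0 (nth [::] h (loc x).1) (loc x).2].

(** Supplies a point, whose color then serves as a default in T. If the level below the slice is
    empty, the piece is a minimum and the level above has points. *)
Lemma step_point j : j < size D -> exists x, j <= (loc x).1 <= j.+1.
Proof.
move=> jD; suff [x [] xE] : exists x, loc x = (j, 0) \/ loc x = (j.+1, 0).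
- by exists x; rewrite xE leqnn leqnSn.
- by exists x; rewrite xE leqnn leqnSn.
case E: (level D j) => [|o l].
  have [] := step_size (step_level jD); rewrite E.
  case: (nth _ _ _) => i [b||c0] /=; try by rewrite addn2.
  move=> _ s2; have [|x xE] := @locP j.+1 0 jD; first by rewrite s2.
  by exists x; right.
have [|x xE] := @locP j 0 (ltnW jD); first by rewrite E.
by exists x; left.
Qed.

Lemma coloring_trajs h c : shows h c -> coloring c <-> h \in trajs D [::].
Proof.
move=> [sh hl hc].
have key (t0 : T) : coloring c <-> forall j, j < size D ->
    nth [::] h j.+1 \in trans (nth (0, Cap) D j) (nth [::] h j).
  pose V (jk : nat * nat) := color t0 (nth [::] h jk.1) jk.2.
  have cV x : c x = V (loc x) by apply: hc.
  rewrite (coloringP cV); split=> H j jD; have := H j jD;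
    have := step_level jD; rewrite -!hl ?(ltnW jD) //;
    case: (nth _ _ _) => i p st; have := transP t0 st; rewrite size_map => tP.
    by move/tP.
  by move/tP.
split=> [col|/trajsP [_ _ H]]; last first.
  by split=> [x y xy|pos ui oi uo oo q];
    [have [h1 _] := proj2 (key (c x)) H; apply: h1
    |have [_ h2] := proj2 (key (c ui)) H; apply: h2].
apply/trajsP; split=> // [|j jD].
  by apply/nilP; rewrite /nilp -(size_map fst) -/(unzip1 _) hl // /level take0.
by have [x _] := step_point jD; apply: (proj1 (key (c x))).
Qed.

Lemma trajs_level (h : seq (state T)) : h \in trajs D [::] ->
  forall j, j <= size D -> unzip1 (nth [::] h j) = level D j.
Proof.
move=> /trajsP [_ h0 H]; elim=> [|j IHj] jD; first by rewrite h0 /level take0.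
have := trans_step (H j jD); rewrite IHj ?(ltnW jD) // step_level // => -[] //.
Qed.

Lemma trajs_shows (h : seq (state T)) : h \in trajs D [::] -> exists c, shows h c.
Proof.
move=> hT; have hl := trajs_level hT.
suff /choice [c cP] : forall x, exists t, forall t0 : T,
    t = color t0 (nth [::] h (loc x).1) (loc x).2.
  by exists c; split=> //; case/trajsP: hT.
move=> x; have [jD] := loc_bound x; rewrite -hl // size_map.
case: (nth [::] h _) => // -[o t] s ks.
by exists (color t ((o, t) :: s) (loc x).2) => t0;
  rewrite /color (set_nth_default (true, t0)).
Qed.

Definition level_state c (j : 'I_(size D).+1) : state T :=
  [seq (nth true (level D j) (nat_of_ord k), c (existT _ j k))
    | k : 'I_(size (level D j)) <- enum 'I_(size (level D j))].

Definition traj c : seq (state T) := [seq level_state c j | j <- enum 'I_(size D).+1].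

Lemma traj_shows c : shows (traj c) c.
Proof.
have nthE (j : 'I_(size D).+1) : nth [::] (traj c) j = level_state c j.
  by rewrite (nth_map j) ?size_enum_ord // nth_ord_enum.
split=> [|j jD|t0 [j k]].
- by rewrite size_map size_enum_ord.
- have -> : j = Ordinal (jD : j < (size D).+1) by [].
  rewrite nthE /unzip1 /level_state -map_comp; apply: (@eq_from_nth _ true).
    by rewrite size_map size_enum_ord.
  move=> k; rewrite size_map size_enum_ord => kl.
  by rewrite (nth_map (Ordinal kl)) ?size_enum_ord //= nth_enum_ord.
- by rewrite /color /= nthE /level_state (nth_map k) ?size_enum_ord // nth_ord_enum.
Qed.

Lemma shows_inj h c c' : shows h c -> shows h c' -> c = c'.
Proof.
by move=> [_ _ e1] [_ _ e2]; apply/funext => x; rewrite (e1 (c x)) -(e2 (c x)).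
Qed.

Lemma shows_fun h h' c : shows h c -> shows h' c -> h = h'.
Proof.
move=> [s1 l1 e1] [s2 l2 e2]; apply: (@eq_from_nth _ [::]); first by rewrite s1.
rewrite s1 => j jD; have := l1 j jD; have := l2 j jD => e e'.
case E: (nth [::] h j) => [|[o t0] s].
  by apply/esym/nilP; rewrite /nilp -(size_map fst) -/(unzip1 _) e -e' E.
rewrite -E; apply: (@eq_state _ t0) => [|k]; first by rewrite e.
rewrite -(size_map fst) -/(unzip1 _) e' => /(locP jD) [x xE].
by have := e1 t0 x; rewrite (e2 t0 x) xE.
Qed.

Local Notation K := (knot_biquandle D).
Local Notation gen x := (\pi_(presented (knot_presentation D)) (Gen (semiarc_of x)))%qT.

Lemma joined_sym : symmetric (@joined D).
Proof.
by move=> x y; apply/existsP/existsP => -[j h]; exists j; rewrite /= orbC.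
Qed.

Lemma semiarc_joined x y : joined x y -> semiarc_of x = semiarc_of y.
Proof.
move=> xy; apply: val_inj; apply/setP => z; rewrite !inE.
by apply: same_connect (sym_connect_sym joined_sym) _ _ _ _; apply: connect1.
Qed.

Lemma semiarc_ofP (A : semiarc D) : exists x, semiarc_of x = A.
Proof. by case: A => A /[dup] /codomP [x E] H; exists x; apply: val_inj. Qed.

Lemma knot_relsP u v : reflect
  (exists q, @crossing_ends D q /\ (u, v) \in crossing_rels q)
  ((u, v) \in rels (knot_presentation D)).
Proof.
apply: (iffP flatten_mapP) => -[q]; rewrite ?mem_enum; first by exists q.
by case=> h1 h2; exists q => //; rewrite mem_enum.
Qed.

Lemma hom_coloring (phi : K -> T) : is_hom phi -> coloring (fun x => phi (gen x)).
Proof.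
move=> hphi; split=> [x y xy|pos ui oi uo oo q]; first by rewrite (semiarc_joined xy).
have R u v : (u, v) \in crossing_rels (pos, (ui, oi), (uo, oo)) ->
    (\pi_(presented (knot_presentation D)) u =
     \pi_(presented (knot_presentation D)) v)%qT.
  by move=> uv; apply/presented_eqP/we_rel/knot_relsP; exists (pos, (ui, oi), (uo, oo)).
have H1 := hom_cls hphi (Gen (semiarc_of ui)) (Gen (semiarc_of oi)).
have H2 := hom_cls hphi (Gen (semiarc_of oi)) (Gen (semiarc_of ui)).
move: R; rewrite /crossing_rels /crossing_colors; case: pos {q} => R.
- by case: H1 H2 => <- _ _ _ [_ _ <- _]; split; congr phi; apply: R;
    rewrite !inE eqxx ?orbT.
- by case: H1 H2 => _ <- _ _ [_ _ _ <-]; split; congr phi; apply: R;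
    rewrite !inE eqxx ?orbT.
Qed.

Lemma coloring_hom c : coloring c ->
  exists2 phi : K -> T, is_hom phi & forall x, phi (gen x) = c x.
Proof.
(* r selects a point on each semiarc; c is constant along chains of joined points, so the selection
   does not matter. *)
move=> [cJ cX]; have [r rP] := choice semiarc_ofP.
have cr x : c (r (semiarc_of x)) = c x.
  have /(congr1 val) /= /setP /(_ x) := rP (semiarc_of x).
  rewrite !inE connect0 => /connectP [s]; elim: s (r _) => [|y s IHs] z /=.
    by move=> _ ->.
  by move=> /andP [/cJ -> /IHs].
have [|phi hphi phiE] := @hom_extend T (knot_presentation D) (c \o r).
  move=> u v /knot_relsP [[[pos [ui oi]] [uo oo]] [/cX]].
  rewrite /crossing_colors /crossing_rels.
  case: pos => -[e1 e2]; rewrite !inE => /orP [] /eqP [-> ->] /=; rewrite !cr //.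
by exists phi => // x; rewrite phiE /= cr.
Qed.

(** A homomorphism is sent to the index of its trajectory, which is a bijection because the list of
    trajectories has no repetition. *)
Lemma card_Hom_knot : (Hom K T #= `I_(size (paths D [::] : seq (state T))))%card.
Proof.
rewrite -size_trajs; set s := trajs _ _.
pose F (phi : K -> T) := traj (fun x => phi (gen x)).
have Fs phi : is_hom phi -> F phi \in s.
  by move=> /hom_coloring /(coloring_trajs (traj_shows _)).
apply/pcard_eqP; suff /Pbij[f] :
    set_bij (Hom K T) `I_(size s) (fun phi => index (F phi) s).
  by squash f.
split.
- by move=> phi /= /Fs; rewrite index_mem.
- move=> phi psi /set_mem hphi /set_mem hpsi e.
  have {}e : F phi = F psi.
    by rewrite -(nth_index [::] (Fs _ hphi)) e nth_index // Fs.
  have e' := shows_inj (traj_shows (fun x => phi (gen x))).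
  apply: hom_ext => // A; have [x <-] := semiarc_ofP A.
  move: (e' (fun x => psi (gen x))); rewrite -/(F phi) e => /(_ (traj_shows _)).
  by move/(congr1 (@^~ x)).
- move=> n /= ns; have hT : nth [::] s n \in s by apply: mem_nth.
  have [c hc] := trajs_shows hT.
  have [phi hphi phiE] := coloring_hom (proj2 (coloring_trajs hc) hT).
  exists phi => //; rewrite (_ : F phi = nth [::] s n) ?index_uniq ?trajs_uniq //.
  by apply: (shows_fun (traj_shows _)); rewrite (_ : (fun x => _) = c) //; apply/funext.
Qed.
End Diagram.

Local Open Scope card_scope.

Theorem theorem3 (T : finBiquandleType) :
  (forall K K' : biquandleType,
     finitely_presented K -> finitely_presented K' -> isomorphic K K' ->
     Hom K T #= Hom K' T) /\
  (forall D D' : diagram, virtually_isotopic D D' ->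
     Hom (knot_biquandle D) T #= Hom (knot_biquandle D') T).
Proof.
split=> [K K' _ _ [phi [[h1 h2 h3 h4] [psi phiK psiK]]]|D D' /(paths_isotopic T) e].
  have g1 a b : psi (up a b) = up (psi a) (psi b).
    by rewrite -[a in LHS]psiK -[b in LHS]psiK -h1 phiK.
  have g2 a b : psi (upb a b) = upb (psi a) (psi b).
    by rewrite -[a in LHS]psiK -[b in LHS]psiK -h2 phiK.
  have g3 a b : psi (dn a b) = dn (psi a) (psi b).
    by rewrite -[a in LHS]psiK -[b in LHS]psiK -h3 phiK.
  have g4 a b : psi (dnb a b) = dnb (psi a) (psi b).
    by rewrite -[a in LHS]psiK -[b in LHS]psiK -h4 phiK.
  (* Precomposition with the inverse isomorphism psi is onto Hom(K', T), and composing with phi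
     shows that it is injective. *)
  have -> : Hom K' T = ((fun f => f \o psi) @` Hom K T)%classic.
    apply/seteqP; split=> [f [f1 f2 f3 f4]|_ [f [f1 f2 f3 f4] <-]] /=.
      exists (f \o phi); last by apply/funext => x /=; rewrite psiK.
      by split=> a b /=; rewrite ?h1 ?h2 ?h3 ?h4 ?f1 ?f2 ?f3 ?f4.
    by split=> a b /=; rewrite ?g1 ?g2 ?g3 ?g4 ?f1 ?f2 ?f3 ?f4.
  apply: card_esym; apply: inj_card_eq => f g _ _ /(congr1 (fun k => k \o phi)) fg.
  apply/funext => x; have := congr1 (@^~ x) fg.
  by rewrite /= phiK.
apply: card_eq_trans (card_Hom_knot T D) _.
by rewrite e card_eq_sym card_Hom_knot.
Qed.
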